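(* Let $G$ be a graph that is $(\le 2)$-quasimonophobic, i.e. $n$-quasimonophobic for every $0\le n\le 2$. Then $$H_2(G)\cong H_2\bigl(CW^\Box(G)\bigr).$$
   Context: Graphs are simple and undirected (no loops, no multiple edges). A graph map $f\colon G\to G'$ is a map of vertex sets sending every edge to an edge or to a single vertex; its image $\operatorname{Im}(f)$ is the subgraph of $G'$ with vertex set $f(V(G))$ and only those edges of $G'$ that are images of edges of $G$. $I^n$ denotes the discrete $n$-cube graph, with vertex set $\{0,1\}^n$, two vertices being adjacent iff they differ in exactly one coordinate ($I^0$ is a single vertex). A singular $n$-cube in $G$ is a graph map $\sigma\colon I^n\to G$; it is injective if it is injective on vertices. For $1\le i\le n$, $f_i^-\sigma$ and $f_i^+\sigma$ are the singular $(n-1)$-cubes (the faces of $\sigma$) obtained by fixing the $i$-th coordinate equal to $0$ and $1$ respectively. $\sigma$ is degenerate if $f_i^-\sigma=f_i^+\sigma$ for some $i$. Let $Q_n(G)$ be the free abelian group on singular $n$-cubes, with $\partial_n\sigma=\sum_{i=1}^n(-1)^i(f_i^-\sigma-f_i^+\sigma)$, let $D_*(G)\subseteq Q_*(G)$ be the subcomplex generated by degenerate cubes, $C_*(G)=Q_*(G)/D_*(G)$, and $H_n(G)=H_n(C_*(G))$ (discrete cubical homology). An $n$-cube in $G$ is a subgraph isomorphic to $I^n$; it is rigid if it is an induced subgraph of $G$. A singular $n$-cube is supported by an $n$-cube $Q$ if its image equals $Q$. A rigid $n$-cube $Q$ in $G$ is quasimonophobic if, whenever a noninjective singular $(n+1)$-cube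 in $G$ has a face $f_i^{\pm}$ supported by $Q$, it has at least one additional face (for a different choice of index and sign) supported by $Q$. $G$ is $n$-quasimonophobic if every $n$-cube in $G$ is rigid and quasimonophobic. $CW^\Box(G)$ is the CW complex obtained by filling in the cubes of $G$: its $n$-cells are solid $n$-cubes in bijection with the subgraphs of $G$ isomorphic to $I^n$, and the faces of the cell of a subgraph $D\cong I^n$ are identified with the cells of the corresponding $(n-1)$-cube subgraphs of $D$. $H_2(CW^\Box(G))$ is its ordinary integral (cellular) homology. *)

(* Defs.v *)
From HB Require Import structures.
From mathcomp Require Import freeg.
From mathcomp Require Import all_boot all_order perm all_algebra zify ring.
From mathcomp Require Import boolp.

Set Implicit Arguments.
Unset Strict Implicit.
Unset Printing Implicit Defensive.

Import GRing.Theory.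
Local Open Scope ring_scope.
Local Open Scope quotient_scope.

(* The vertex set may be infinite. *)
Record sgraph := SGraph {
  vertex :> choiceType;
  adj : rel vertex;
  adj_sym : symmetric adj;
  adj_irr : irreflexive adj }.

Definition graph_map (G G' : sgraph) (f : G -> G') : Prop :=
  forall x y, adj x y -> adj (f x) (f y) \/ f x = f y.

Record subgraph (G : sgraph) := Subgraph {
  sverts : G -> Prop;
  sadj : G -> G -> Prop;
  sadj_sym : forall u v, sadj u v -> sadj v u;
  sadj_adj : forall u v, sadj u v -> adj u v;
  sadj_verts : forall u v, sadj u v -> sverts u }.

HB.instance Definition _ G := gen_eqMixin (subgraph G).
HB.instance Definition _ G := gen_choiceMixin (subgraph G).

Definition induced (G : sgraph) (Q : subgraph G) : Prop :=
  forall u v, sverts Q u -> sverts Q v -> adj u v -> sadj Q u v.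

(* Edges of the domain collapsed to a vertex give no edge of the image, since
   the image edges are required to be edges of the target. *)
Section Image.
Variables (G G' : sgraph) (f : G -> G').

Definition im_verts (v : G') : Prop := exists x, f x = v.
Definition im_adj (u v : G') : Prop :=
  adj u v /\ exists x y, [/\ adj x y, f x = u & f y = v].

Fact im_adj_sym u v : im_adj u v -> im_adj v u.
Proof.
case=> uv [x [y [xy fx fy]]]; split; first by rewrite adj_sym.
by exists y, x; rewrite adj_sym.
Qed.

Fact im_adj_adj u v : im_adj u v -> adj u v.
Proof. by case. Qed.

Fact im_adj_verts u v : im_adj u v -> im_verts u.
Proof. by case=> _ [x [y [_ fx _]]]; exists x. Qed.

Definition graph_image : subgraph G' := Subgraph im_adj_sym im_adj_adj im_adj_verts.

End Image.

(* f is an isomorphism from G onto the subgraph Q. *)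
Definition is_subgraph_iso (G G' : sgraph) (f : G -> G') (Q : subgraph G') :=
  [/\ injective f,
      forall v, sverts Q v <-> exists x, f x = v
    & forall x y, sadj Q (f x) (f y) <-> adj x y].

Notation cube n := {ffun 'I_n -> bool}.

Section CubeGraph.
Variable n : nat.
Implicit Types x y : cube n.

Definition cube_adj x y := #|[pred i | x i != y i]| == 1%N.

Fact cube_adj_sym : symmetric cube_adj.
Proof. by move=> x y; congr (_ == _); apply: eq_card => i; rewrite !inE eq_sym. Qed.

Fact cube_adj_irr : irreflexive cube_adj.
Proof. by move=> x; rewrite /cube_adj eq_card0 // => i; rewrite !inE eqxx. Qed.

Definition cube_graph := SGraph cube_adj_sym cube_adj_irr.

End CubeGraph.

Record scube (G : sgraph) (n : nat) := SCube {
  scube_fun :> {ffun cube n -> G};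
  _ : `[< @graph_map (cube_graph n) G scube_fun >] }.

HB.instance Definition _ G n := [isSub for @scube_fun G n].
HB.instance Definition _ G n := [Choice of scube G n by <:].

Lemma scubeP (G : sgraph) n (s : scube G n) : @graph_map (cube_graph n) G s.
Proof. by case: s => s /= /asboolP. Qed.

(* Coordinates are numbered from 0; ins i e inserts the value e (false for 0,
   true for 1) as the i-th coordinate, so that face i false and face i true are
   f_(i+1)^- and f_(i+1)^+. *)
Definition ins n (i : 'I_n.+1) (e : bool) (x : cube n) : cube n.+1 :=
  [ffun k => if unlift i k is Some j then x j else e].

Lemma insE n i e (x : cube n) : ins i e x i = e.
Proof. by rewrite ffunE unlift_none. Qed.

Lemma ins_liftE n i e (x : cube n) j : ins i e x (lift i j) = x j.
Proof. by rewrite ffunE liftK. Qed.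

Lemma ins_adj n i e (x y : cube n) :
  cube_adj (ins i e x) (ins i e y) = cube_adj x y.
Proof.
congr (_ == _); rewrite -(card_image (@lift_inj _ i)); apply: eq_card => k.
rewrite !inE; apply/idP/imageP.
  rewrite !ffunE; case: unliftP => [j ->|_]; last by rewrite eqxx.
  by move=> xy; exists j.
by case=> j; rewrite !inE => xy ->; rewrite !ins_liftE.
Qed.

Section Face.
Variables (G : sgraph) (n : nat) (i : 'I_n.+1) (e : bool) (s : scube G n.+1).

Fact face_subproof :
  `[< @graph_map (cube_graph n) G [ffun x => s (ins i e x)] >].
Proof.
apply/asboolP => x y xy; rewrite !ffunE; apply: (scubeP s).
by rewrite /= ins_adj.
Qed.

Definition face : scube G n := SCube face_subproof.

Lemma faceE x : face x = s (ins i e x).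
Proof. by rewrite ffunE. Qed.
End Face.

Definition degenerate (G : sgraph) n : scube G n -> Prop :=
  match n with
  | 0 => fun _ => False
  | m.+1 => fun s => exists i, face i false s = face i true s
  end.

Definition is_cube (G : sgraph) n (Q : subgraph G) : Prop :=
  exists f : cube n -> G, @is_subgraph_iso (cube_graph n) G f Q.

Definition supported (G : sgraph) n (s : scube G n) (Q : subgraph G) : Prop :=
  @graph_image (cube_graph n) G s = Q.

Definition rigid (G : sgraph) (Q : subgraph G) : Prop := induced Q.

Definition quasimonophobic (G : sgraph) n (Q : subgraph G) : Prop :=
  forall s : scube G n.+1, ~ injective s ->
  forall i e, supported (face i e s) Q ->
  exists i' e', (i', e') <> (i, e) /\ supported (face i' e' s) Q.

Definition quasimonophobic_graph (G : sgraph) n : Prop :=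
  forall Q : subgraph G, is_cube n Q -> rigid Q /\ quasimonophobic n Q.

(* The subgroup generated by X, as the intersection of all subgroups
   containing X. *)
Section Span.
Variables (V : zmodType) (X : V -> Prop).
Definition zspan : {pred V} := fun v =>
  `[< forall S : zmodClosed V, (forall x, X x -> x \in S) -> v \in S >].

Fact zspan_closed : zmod_closed zspan.
Proof.
split; first by apply/asboolP => S _; exact: rpred0.
move=> u v /asboolP hu /asboolP hv; apply/asboolP => S XS.
by rewrite rpredB ?hu ?hv.
Qed.

HB.instance Definition _ := GRing.isZmodClosed.Build V zspan zspan_closed.
End Span.

Record chain_complex := ChainComplex {
  chain : nat -> zmodType;
  bd : forall n, {additive chain n.+1 -> chain n};
  bd_bd : forall n (x : chain n.+2), bd n (bd n.+1 x) = 0 }.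

Section Homology.
Variables (C : chain_complex) (n : nat).

Definition is_cycle : {pred chain C n} :=
  match n return chain C n -> bool with
  | 0 => fun _ => true
  | m.+1 => fun x => bd C m x == 0
  end.

Fact is_cycle_closed : zmod_closed is_cycle.
Proof.
rewrite /is_cycle; case: n => [|m]; first by [].
split; first by rewrite unfold_in /= raddf0.
by move=> x y /eqP x0 /eqP y0; rewrite unfold_in raddfB /= x0 y0 subrr.
Qed.
HB.instance Definition _ := GRing.isZmodClosed.Build _ is_cycle is_cycle_closed.

Record cycles := Cycles { cycle_val : chain C n; _ : cycle_val \in is_cycle }.
HB.instance Definition _ := [isSub for cycle_val].
HB.instance Definition _ := [Choice of cycles by <:].
HB.instance Definition _ := [SubChoice_isSubZmodule of cycles by <:].

Definition is_boundary : {pred cycles} :=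
  fun z => `[< exists c : chain C n.+1, bd C n c = cycle_val z >].

Fact is_boundary_closed : zmod_closed is_boundary.
Proof.
split; first by apply/asboolP; exists 0; rewrite raddf0.
move=> x y /asboolP[c cx] /asboolP[d dy]; apply/asboolP; exists (c - d).
by rewrite raddfB cx dy.
Qed.
HB.instance Definition _ :=
  GRing.isZmodClosed.Build _ is_boundary is_boundary_closed.

Definition homology : zmodType := Quotient.quot is_boundary.
End Homology.

Definition isomorphic (A B : zmodType) : Prop :=
  exists f : {additive A -> B}, bijective f.

Section Fglift.
Variables (K : choiceType) (M : lmodType int) (f : K -> M).
Fact fglift_is_additive : zmod_morphism (fglift f : {freeg K / int} -> M).
Proof. exact: lift_is_additive. Qed.
HB.instance Definition _ :=
  GRing.isZmodMorphism.Build {freeg K / int} M (fglift f) fglift_is_additive.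
End Fglift.

Section FreeAbelian.
Variables (K : choiceType).

Definition gen (k : K) : {freeg K / int} := << k >>.

Lemma fglift_gen (M : lmodType int) (f : K -> M) k : fglift f (gen k) = f k.
Proof. by rewrite liftU scale1r. Qed.

Lemma freeg_additive0 (V : zmodType) (h : {additive {freeg K / int} -> V}) :
  (forall k, h (gen k) = 0) -> forall c, h c = 0.
Proof.
move=> h0; elim/freeg_ind_dom0 => [|z k c _ _ hc]; first by rewrite raddf0.
have -> : << z *g k >> = gen k *~ z by rewrite /gen freegU_mulz intz.
by rewrite raddfD /= raddfMz h0 mul0rz hc addr0.
Qed.
End FreeAbelian.

Section CubicalIdentities.

(* The 0-based indices (i, j) of a double face correspond under this involution
   to the indices of the same double face taken in the other order. *)
Definition lift_swap n (p : 'I_n.+2 * 'I_n.+1) : 'I_n.+2 * 'I_n.+1 :=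
  (lift p.1 p.2, odflt p.2 (unlift (lift p.1 p.2) p.1)).

Lemma lift_swapE n (p : 'I_n.+2 * 'I_n.+1) :
  lift (lift_swap p).1 (lift_swap p).2 = p.1.
Proof.
case: p => i j; rewrite /lift_swap /=.
by case: unliftP => [k <-|/eqP] //; rewrite (negPf (neq_lift _ _)).
Qed.

Lemma lift_swapK n : involutive (@lift_swap n).
Proof.
move=> p; have p1 := lift_swapE p.
rewrite {1}/lift_swap p1 /=; case: p p1 => i j /= p1.
by rewrite liftK.
Qed.

Lemma lift_swap_val n (p : 'I_n.+2 * 'I_n.+1) :
  let q := lift_swap p in
  if (p.2 < p.1)%N then (q.1 = p.2 :> nat) /\ (q.2.+1 = p.1 :> nat)
  else (q.1 = p.2.+1 :> nat) /\ (q.2 = p.1 :> nat).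
Proof.
case: p => i j /=; have /(congr1 val) := lift_swapE (i, j).
rewrite /= /bump; set k := odflt _ _; clearbody k.
case: ltnP => ij; rewrite ?add0n ?add1n; case: leqP => h.
all: by rewrite ?add0n ?add1n => h2; lia.
Qed.

Lemma ins_ins n (p : 'I_n.+2 * 'I_n.+1) e e' (x : cube n) :
  ins p.1 e (ins p.2 e' x) =
  ins (lift_swap p).1 e' (ins (lift_swap p).2 e x).
Proof.
set q := lift_swap p; apply/ffunP => k.
have [k1 ->|->] := unliftP p.1 k; last first.
  by rewrite insE -(lift_swapE p) ins_liftE insE.
rewrite ins_liftE; have [m ->|->] := unliftP p.2 k1; last first.
  by rewrite insE -[lift p.1 p.2]/(q.1) insE.
rewrite ins_liftE.
suff -> : lift p.1 (lift p.2 m) = lift q.1 (lift q.2 m) by rewrite !ins_liftE.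
apply/val_inj => /=; have := lift_swap_val p; rewrite -/q /= /bump.
case: ltnP => h0 [-> h]. all: by lia.
Qed.

Lemma face_face (G : sgraph) n (p : 'I_n.+2 * 'I_n.+1) e e' (s : scube G n.+2) :
  face p.2 e' (face p.1 e s) =
  face (lift_swap p).2 e (face (lift_swap p).1 e' s).
Proof. by apply/val_inj/ffunP => x; rewrite !faceE ins_ins. Qed.

Lemma face_face_sum (G : sgraph) n (V : zmodType) (u : scube G n -> V)
    (s : scube G n.+2) :
  \sum_(i < n.+2) \sum_(j < n.+1) \sum_e \sum_e'
     (u (face j e' (face i e s)) *~ ((-1) ^+ (i + e) * (-1) ^+ (j + e'))) = 0.
Proof.
rewrite pair_big /=.
rewrite (bigID (fun p : 'I_n.+2 * 'I_n.+1 => (p.2 < p.1)%N)) /=.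
rewrite [X in _ + X](reindex_inj (inv_inj (@lift_swapK n))) /=.
rewrite [X in _ + X](eq_bigl (fun p : 'I_n.+2 * 'I_n.+1 => (p.2 < p.1)%N)); last first.
  move=> p; have := lift_swap_val p; rewrite /=.
  case: (ltnP p.2 p.1) => h [h1 h2]; apply/idP/idP => //; lia.
rewrite -big_split /= big1 // => p lt_p.
rewrite exchange_big /= -big_split /= big1 // => e' _.
rewrite -big_split /= big1 // => e _.
rewrite face_face -mulrzDr.
have := lift_swap_val p; rewrite lt_p /= => -[h1 h2].
suff -> : ((-1) ^+ (p.1 + e) * (-1) ^+ (p.2 + e') +
   (-1) ^+ ((lift_swap p).1 + e') * (-1) ^+ ((lift_swap p).2 + e) : int) = 0.
  by rewrite mulr0z.
rewrite -!exprD -h2 -h1 [X in _ ^+ X + _](_ : _ =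
  (lift p.1 p.2 + e' + (odflt p.2 (unlift (lift p.1 p.2) p.1) + e)).+1).
  by rewrite exprS mulN1r addNr.
by rewrite /=; lia.
Qed.
End CubicalIdentities.

Section CubicalChains.
Variable G : sgraph.

Definition Qchain n : lmodType int := {freeg (scube G n) / int}.

(* The exponent is i.+1 because coordinates are numbered from 0. *)
Definition bdQ n : {additive Qchain n.+1 -> Qchain n} :=
  fglift (fun s : scube G n.+1 => \sum_(i < n.+1)
    (-1) ^+ i.+1 *: (gen (face i false s) - gen (face i true s))).

Lemma bdQ_gen n (s : scube G n.+1) :
  bdQ n (gen s) = \sum_(i < n.+1)
    (-1) ^+ i.+1 *: (gen (face i false s) - gen (face i true s)).
Proof. exact: fglift_gen. Qed.

Lemma signed_faces (V : zmodType) n (u : bool -> V) (i : 'I_n.+1) :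
  (u false - u true) *~ (-1) ^+ i.+1 = \sum_e - (u e *~ (-1) ^+ (i + e)).
Proof.
rewrite big_bool /= addn0 addn1 exprS mulN1r.
by rewrite !mulrNz opprK mulrzBl opprB.
Qed.

Lemma bdQ_genE n (s : scube G n.+1) :
  bdQ n (gen s) =
  - \sum_(i < n.+1) \sum_e (gen (face i e s) *~ (-1) ^+ (i + e)).
Proof.
rewrite bdQ_gen -sumrN; apply: eq_bigr => i _.
by rewrite -[X in X *: _]intz scaler_int (signed_faces (fun e => gen (face i e s))) -sumrN.
Qed.

Lemma bdQ_bdQ n (c : Qchain n.+2) : bdQ n (bdQ n.+1 c) = 0.
Proof.
move: c; apply: (freeg_additive0 (h := bdQ n \o bdQ n.+1)) => s /=.
rewrite bdQ_genE raddfN /= raddf_sum /= -[RHS](face_face_sum (@gen _) s) /=.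
rewrite -sumrN; apply: eq_bigr => i _.
rewrite raddf_sum /= [RHS]exchange_big /= -sumrN; apply: eq_bigr => e _.
rewrite raddfMz /= bdQ_genE mulNrz opprK mulrz_suml; apply: eq_bigr => j _.
rewrite mulrz_suml; apply: eq_bigr => e' _.
by rewrite -mulrzA mulrC.
Qed.

Definition Dchain n : {pred Qchain n} :=
  zspan (fun c => exists s : scube G n, degenerate s /\ c = gen s).

HB.instance Definition _ n := GRing.ZmodClosed.on (@Dchain n).

Lemma Dchain_gen n (s : scube G n) : degenerate s -> gen s \in @Dchain n.
Proof. by move=> ds; apply/asboolP => S; apply; exists s. Qed.

Lemma degenerate_face n (i0 : 'I_n.+2) (j : 'I_n.+1) e (s : scube G n.+2) :
  face i0 false s = face i0 true s -> degenerate (face (lift i0 j) e s).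
Proof.
move=> si0; exists (lift_swap (i0, j)).2.
by rewrite -!(face_face (i0, j) _ e) /= si0.
Qed.

Lemma bdQ_degenerate n (s : scube G n.+1) :
  degenerate s -> bdQ n (gen s) \in @Dchain n.
Proof.
case: n s => [|n] s [i0 si0]; rewrite bdQ_gen; apply: rpred_sum => i _.
  by rewrite !ord1 in si0 *; rewrite si0 subrr scaler0 rpred0.
have [j ->|->] := unliftP i0 i; last by rewrite si0 subrr scaler0 rpred0.
rewrite -[X in X *: _]intz scaler_int rpredMz //.
by rewrite rpredB ?Dchain_gen //; apply: degenerate_face.
Qed.

Lemma bdQ_Dchain n (c : Qchain n.+1) : c \in @Dchain n.+1 -> bdQ n c \in @Dchain n.
Proof.
pose S : {pred Qchain n.+1} := fun c => bdQ n c \in @Dchain n.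
have S_closed : zmod_closed S.
  split; rewrite /S; first by rewrite unfold_in raddf0 rpred0.
  by move=> x y xS yS; rewrite unfold_in raddfB /= rpredB.
pose S' : zmodClosed _ := HB.pack S (GRing.isZmodClosed.Build _ S S_closed).
by move=> /asboolP /(_ S'); apply=> _ [s [ds ->]]; apply: bdQ_degenerate.
Qed.

Definition Cchain n : zmodType := Quotient.quot (@Dchain n).

Definition bdC_fun n (c : Cchain n.+1) : Cchain n :=
  \pi_(Quotient.quot (@Dchain n)) (bdQ n (repr c)).

Lemma bdC_pi n (c : Qchain n.+1) :
  bdC_fun (\pi_(Quotient.quot (@Dchain n.+1)) c) =
  \pi_(Quotient.quot (@Dchain n)) (bdQ n c).
Proof.
apply/eqP; rewrite -Quotient.idealrBE -raddfB /=; apply: bdQ_Dchain.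
by rewrite Quotient.idealrBE reprK.
Qed.

Fact bdC_is_additive n : zmod_morphism (@bdC_fun n).
Proof.
move=> x y; rewrite -[x]reprK -[y]reprK -raddfB /= !bdC_pi !raddfB /=.
by [].
Qed.
HB.instance Definition _ n :=
  GRing.isZmodMorphism.Build _ _ (@bdC_fun n) (@bdC_is_additive n).

Definition bdC n : {additive Cchain n.+1 -> Cchain n} := @bdC_fun n.

Lemma bdC_bdC n (c : Cchain n.+2) : bdC n (bdC n.+1 c) = 0.
Proof. by rewrite -[c]reprK /bdC /= !bdC_pi bdQ_bdQ raddf0. Qed.

Definition cubical_complex : chain_complex := ChainComplex bdC_bdC.
End CubicalChains.

(* Every automorphism of the cube graph is the restriction of a signed
   permutation of the coordinates of [0,1]^n; this makes the sign in the cellular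
   boundary computable. *)
Section CubeAutomorphisms.

Definition flip n (j : 'I_n) (x : cube n) : cube n :=
  [ffun k => x k (+) (k == j)].

Lemma flipK n j : involutive (@flip n j).
Proof. by move=> x; apply/ffunP => k; rewrite !ffunE addbK. Qed.

Lemma flipC n j k (x : cube n) : flip j (flip k x) = flip k (flip j x).
Proof. by apply/ffunP => l; rewrite !ffunE addbAC. Qed.

Lemma flip_inj n (x : cube n) : injective (fun j => flip j x).
Proof.
move=> j k /ffunP /(_ j); rewrite !ffunE eqxx => /addbI /esym.
by move=> /eqP.
Qed.

Lemma cube_adjP n (x y : cube n) :
  reflect (exists j, y = flip j x) (cube_adj x y).
Proof.
apply: (iffP eqP) => [/mem_card1[j jP]|[j ->]].
  exists j; apply/ffunP => k; have := jP k; rewrite !inE ffunE.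
  by case: (x k) (y k) => [] [] <-.
by apply: (@eq_card1 _ j) => k; rewrite !inE !ffunE; case: (x k) (k == j) => [] [].
Qed.

Lemma flip_square n (a : cube n) i k p q :
  i != k -> flip p (flip i a) = flip q (flip k a) -> flip p (flip i a) != a ->
  p = k.
Proof.
move=> ik /ffunP eqf; apply: contraNeq => pk; apply/eqP.
have pi : p = i.
  have := eqf i; have := eqf p; rewrite !ffunE !eqxx (negPf pk) (negPf ik).
  rewrite -[i == p]eq_sym; have [//|pi] := eqVneq p i.
  rewrite !addbF => /addbI qp /addbI qi.
  by move: pi; rewrite (eqP (esym qp)) (eqP (esym qi)) eqxx.
by rewrite pi flipK.
Qed.

Lemma cube_flip_ind n (P : cube n -> Prop) :
  P [ffun=> false] -> (forall x j, P x -> P (flip j x)) -> forall x, P x.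
Proof.
move=> P0 Pf x; have [m] := ubnP #|[pred i | x i]|; elim: m x => // m IHm x.
rewrite ltnS => le_m; have [j /= xj|x0] := pickP [pred i | x i]; last first.
  by rewrite (_ : x = [ffun=> false]) //; apply/ffunP => k; rewrite ffunE [LHS]x0.
rewrite -(flipK j x); apply/Pf/IHm; apply: leq_trans le_m.
apply: proper_card; apply/properP; split; last first.
  by exists j; rewrite !inE // ffunE eqxx xj.
apply/subsetP => k; rewrite !inE ffunE; case: (k =P j) => [->|_]; first by rewrite xj.
by rewrite addbF.
Qed.

Definition cube_aut n (g : cube n -> cube n) :=
  injective g /\ forall x y, cube_adj x y -> cube_adj (g x) (g y).

Definition signed_perm n (p : 'S_n) (c : 'I_n -> bool) (g : cube n -> cube n) :=
  forall x j, g x (p j) = x j (+) c j.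

Lemma cube_aut_signed_perm n (g : cube n -> cube n) :
  cube_aut g -> exists p c, signed_perm p c g.
Proof.
case=> g_inj g_adj; pose o : cube n := [ffun=> false].
have gf x j : exists i, g (flip j x) = flip i (g x).
  by apply/cube_adjP/g_adj/cube_adjP; exists j.
have [p0 p0E] := choice (gf o).
have gp x j : g (flip j x) = flip (p0 j) (g x).
  elim/cube_flip_ind: x j => [|x k IHx] j; first exact: p0E.
  have [->|jk] := eqVneq j k; first by rewrite flipK IHx flipK.
  have pjk : p0 j != p0 k.
    by apply: contraNneq jk => pjk; apply/eqP/(@flip_inj _ x)/g_inj; rewrite !IHx pjk.
  have [i iE] := gf (flip k x) j; have [l lE] := gf (flip j x) k.
  rewrite iE IHx; rewrite IHx in iE; rewrite IHx in lE.
  congr flip; apply: (@flip_square _ (g x) (p0 k) (p0 j) i l).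
  - by rewrite eq_sym.
  - by rewrite -iE -lE flipC.
  rewrite -iE (inj_eq g_inj); apply: contraNneq jk => e.
  by apply/eqP/(@flip_inj _ x); rewrite -[in RHS]e flipC flipK.
have p0_inj : injective p0.
  by move=> j k pjk; apply/(@flip_inj _ o)/g_inj; rewrite !gp pjk.
exists (perm p0_inj), (fun j => g o (p0 j)) => x j; rewrite permE.
elim/cube_flip_ind: x => [|x k IHx]; first by rewrite ffunE.
by rewrite gp !ffunE IHx (inj_eq p0_inj) addbAC.
Qed.

Lemma signed_perm_aut n p c (g : cube n -> cube n) :
  signed_perm p c g -> cube_aut g.
Proof.
move=> gE; have gf x j : g (flip j x) = flip (p j) (g x).
  apply/ffunP => k; rewrite -(permKV p k) !ffunE !gE ffunE.
  by rewrite (inj_eq perm_inj) addbAC.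
split=> [x y /ffunP gxy|x y /cube_adjP[j ->]].
  by apply/ffunP => j; have := gxy (p j); rewrite !gE => /addIb.
by apply/cube_adjP; exists (p j).
Qed.

(* When g is an automorphism of the cube graph, it extends to an affine
   automorphism of [0,1]^n, and linear_part g is the (row-vector) matrix of its
   linear part; the determinant, 1 or -1, is the degree of this extension on
   ([0,1]^n, boundary). *)
Definition linear_part n (g : cube n -> cube n) : 'M[int]_n :=
  \matrix_(i, j) ((g [ffun k => k == i] j)%:Z - (g [ffun=> false] j)%:Z).

Section SignedPerm.
Variables (n : nat) (p : 'S_n) (c : 'I_n -> bool) (g : cube n -> cube n).
Hypothesis gE : signed_perm p c g.

Lemma linear_part_signed i j :
  linear_part g i j = (p i == j)%:R * (-1) ^+ c i.
Proof.
rewrite mxE -(permKV p j); set k := (p^-1)%g j.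
rewrite !gE !ffunE (inj_eq perm_inj) eq_sym.
by have [->|_] := eqVneq i k; rewrite ?mul1r ?mul0r; case: (c k).
Qed.

End SignedPerm.

Lemma linear_part_comp n p c p' c' (g g' : cube n -> cube n) :
  signed_perm p c g -> signed_perm p' c' g' ->
  \det (linear_part (g \o g')) = \det (linear_part g') * \det (linear_part g).
Proof.
move=> gE gE'; rewrite -det_mulmx; congr (\det _); apply/matrixP => i j.
have ggE : signed_perm (p' * p)%g (fun j => c' j (+) c (p' j)) (g \o g').
  by move=> x k; rewrite /= permM gE gE' addbA.
rewrite (linear_part_signed ggE) mxE (bigD1 (p' i)) //= big1 ?addr0 => [|k].
  rewrite (linear_part_signed gE) (linear_part_signed gE') eqxx mul1r permM.
  by rewrite mulrCA signr_addb.
by rewrite (linear_part_signed gE') eq_sym => /negPf->; rewrite !mul0r.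
Qed.

Definition restrict n (g : cube n.+1 -> cube n.+1) i j e (x : cube n) : cube n :=
  [ffun k => g (ins i e x) (lift j k)].

Section Restrict.
Variables (n : nat) (p : 'S_n.+1) (c : 'I_n.+1 -> bool) (g : cube n.+1 -> cube n.+1).
Hypothesis gE : signed_perm p c g.

Lemma ins_restrict i e x :
  g (ins i e x) = ins (p i) (e (+) c i) (restrict g i (p i) e x).
Proof.
apply/ffunP => k; have [j ->|->] := unliftP (p i) k.
  by rewrite ins_liftE ffunE.
by rewrite gE !insE.
Qed.

Lemma restrict_signed i e :
  exists p' c', signed_perm p' c' (restrict g i (p i) e).
Proof.
apply: cube_aut_signed_perm; have [g_inj g_adj] := signed_perm_aut gE.
split=> [x y xy|x y xy]; last first.
  by rewrite -(ins_adj (p i) (e (+) c i)) -!ins_restrict g_adj // ins_adj.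
have /ffunP h : ins i e x = ins i e y by apply: g_inj; rewrite !ins_restrict xy.
by apply/ffunP => k; have := h (lift i k); rewrite !ins_liftE.
Qed.

Lemma linear_part_restrict i e :
  linear_part (restrict g i (p i) e) = row' i (col' (p i) (linear_part g)).
Proof.
apply/matrixP => a b; rewrite [RHS]mxE [in RHS]mxE !mxE !ffunE.
set l := lift (p i) b; rewrite -(permKV p l); set m := (p^-1)%g l.
have [m' mE|mE] := unliftP i m; last first.
  by have /eqP := permKV p l; rewrite -/m mE (negPf (neq_lift _ _)).
by rewrite !gE mE !ins_liftE !ffunE (inj_eq lift_inj).
Qed.

Lemma det_linear_part i e :
  \det (linear_part g) =
  (-1) ^+ c i * (-1) ^+ (i + p i) * \det (linear_part (restrict g i (p i) e)).
Proof.
rewrite (expand_det_row _ i) (bigD1 (p i)) //= big1 ?addr0 => [|k pk].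
  by rewrite (linear_part_signed gE) eqxx mul1r linear_part_restrict mulrA.
by rewrite (linear_part_signed gE) eq_sym (negPf pk) !mul0r.
Qed.
End Restrict.
End CubeAutomorphisms.

Lemma subgraph_eq (G : sgraph) (Q Q' : subgraph G) :
  (forall v, sverts Q v <-> sverts Q' v) ->
  (forall u v, sadj Q u v <-> sadj Q' u v) -> Q = Q'.
Proof.
case: Q Q' => [V A a1 a2 a3] [V' A' b1 b2 b3] /= VV' AA'.
have eV : V = V' by apply/funext => v; apply/propext.
have eA : A = A' by apply/funext => u; apply/funext => v; apply/propext.
rewrite {VV' AA'}eV {}eA in a1 a2 a3 *.
by congr Subgraph; apply: Prop_irrelevance.
Qed.

(* The cellular chain complex of the CW complex obtained by filling in the
   cubes of G. Its n-cells are the subgraphs isomorphic to the n-cube graph.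
   Each cell D is attached along a fixed isomorphism char_map D from the n-cube
   graph onto D, which orients D. *)
Record cw_cell (G : sgraph) (n : nat) := CWCell {
  cell_subgraph : subgraph G;
  _ : `[< is_cube n cell_subgraph >] }.
HB.instance Definition _ G n := [isSub for @cell_subgraph G n].
HB.instance Definition _ G n := [Choice of cw_cell G n by <:].

Section Cellular.
Variable G : sgraph.

Definition is_char_map n (s : scube G n) (D : cw_cell G n) : Prop :=
  @is_subgraph_iso (cube_graph n) G s (cell_subgraph D).

Lemma char_map_ex n (D : cw_cell G n) : exists s, is_char_map s D.
Proof.
case: D => Q cQ; have /asboolP[f [f_inj fV fA]] := cQ.
have fP : `[< @graph_map (cube_graph n) G (finfun f) >].
  by apply/asboolP => x y xy; left; rewrite !ffunE; exact: sadj_adj (proj2 (fA x y) xy).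
exists (SCube fP); split=> /=.
- by move=> x y; rewrite !ffunE => /f_inj.
- by move=> v; rewrite fV; split=> -[x <-]; exists x; rewrite ffunE.
by move=> x y; rewrite !ffunE.
Qed.

(* The characteristic map of a cell, fixed by choice. *)
Definition char_map n (D : cw_cell G n) : scube G n := sval (cid (char_map_ex D)).

Lemma char_mapP n (D : cw_cell G n) : is_char_map (char_map D) D.
Proof. by rewrite /char_map; case: cid. Qed.

(* t^-1 \o s for injective cubes t and s with the same image. *)
Definition transition n (t s : scube G n) (x : cube n) : cube n :=
  odflt x [pick y | t y == s x].

(* The chain carried by a cube s that parametrises a cell D: it is D up to the
   sign comparing the orientation given by s with that given by char_map D. *)
Definition cell_class n (s : scube G n) : {freeg (cw_cell G n) / int} :=
  if insub (@graph_image (cube_graph n) G s) is Some D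
  then \det (linear_part (transition (char_map D) s)) *: gen D
  else 0.

Definition CWchain n : lmodType int := {freeg (cw_cell G n) / int}.

(* The boundary of the standard n-cube, each face being identified with the
   cell of the corresponding subgraph: the coefficient of a cell E in the
   boundary of D is the degree of the attaching map of D on E. *)
Definition bdCW n : {additive CWchain n.+1 -> CWchain n} :=
  fglift (fun D : cw_cell G n.+1 => \sum_(i < n.+1) (-1) ^+ i.+1 *:
    (cell_class (face i false (char_map D)) -
     cell_class (face i true (char_map D)))).

Lemma iso_image n (s : scube G n) (Q : subgraph G) :
  @is_subgraph_iso (cube_graph n) G s Q -> @graph_image (cube_graph n) G s = Q.
Proof.
case=> _ sV sA; apply: subgraph_eq => [v|u v]; first by rewrite sV.
split=> [[_ [x [y [xy <- <-]]]]|uv]; first exact/sA.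
have /sV[x xu] := sadj_verts uv; have /sV[y yv] := sadj_verts (sadj_sym uv).
split; first exact: sadj_adj uv.
by exists x, y; split=> //; apply/sA; rewrite xu yv.
Qed.

Lemma inj_iso n (s : scube G n) :
  injective s -> @is_subgraph_iso (cube_graph n) G s (@graph_image (cube_graph n) G s).
Proof.
move=> s_inj; split=> // x y; split=> [[_ [x' [y' [xy /s_inj <- /s_inj <-]]]] //|xy].
split; last by exists x, y.
by case: (scubeP s xy) => // /s_inj exy; rewrite /= exy cube_adj_irr in xy.
Qed.

Lemma image_comp n (s t : scube G n) p c g :
  signed_perm p c g -> (forall x, s x = t (g x)) ->
  @graph_image (cube_graph n) G s = @graph_image (cube_graph n) G t.
Proof.
move=> gE st; have [_ g_adj] := signed_perm_aut gE.
pose h (x : cube n) : cube n := [ffun j => x (p j) (+) c j].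
have hE : signed_perm p^-1%g (fun j => c (p^-1%g j)) h.
  by move=> x j; rewrite ffunE permKV.
have [_ h_adj] := signed_perm_aut hE.
have gh x : g (h x) = x.
  by apply/ffunP => k; rewrite -(permKV p k) gE ffunE addbK.
apply: subgraph_eq => [v|u v]; split.
- by case=> x <-; exists (g x).
- by case=> x <-; exists (h x); rewrite st gh.
- case=> uv [x [y [xy xu yv]]]; split=> //.
  by exists (g x), (g y); rewrite -!st; split=> //; apply: g_adj.
case=> uv [x [y [xy xu yv]]]; split=> //.
by exists (h x), (h y); rewrite !st !gh xu yv; split=> //; apply: h_adj.
Qed.

Lemma cell_class_char n (s : scube G n) (D : cw_cell G n) p c g :
  signed_perm p c g -> (forall x, s x = char_map D (g x)) ->
  cell_class s = \det (linear_part g) *: gen D.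
Proof.
move=> gE sD; have [D_inj _ _] := char_mapP D.
rewrite /cell_class (image_comp gE sD) (iso_image (char_mapP D)) valK.
suff -> : transition (char_map D) s = g by [].
apply/funext => x; rewrite /transition; case: pickP => [y /eqP|/(_ (g x))].
  by rewrite sD => /D_inj.
by rewrite sD eqxx.
Qed.

Lemma inj_char n (s : scube G n) : injective s ->
  exists D p c g, signed_perm p c g /\ forall x, s x = char_map D (g x).
Proof.
move=> s_inj; have [_ sV sA] := inj_iso s_inj.
have Dcube : `[< is_cube n (@graph_image (cube_graph n) G s) >].
  by apply/asboolP; exists s; apply: inj_iso.
pose D := CWCell Dcube; exists D; have [D_inj DV DA] := char_mapP D.
have /choice[g gE] x : exists y, s x = char_map D y.
  have /DV[y <-] : sverts (cell_subgraph D) (s x) by apply/sV; exists x.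
  by exists y.
have [|p [c pcg]] := @cube_aut_signed_perm n g.
  split=> [x y gxy|x y xy]; first by apply: s_inj; rewrite !gE gxy.
  by apply/DA; rewrite -!gE; apply/sA.
by exists p, c, g.
Qed.

Lemma cell_class_comp n (s t : scube G n) p c g :
  injective t -> signed_perm p c g -> (forall x, s x = t (g x)) ->
  cell_class s = \det (linear_part g) *: cell_class t.
Proof.
move=> /inj_char[D [q [d [h [hE tE]]]]] gE st.
rewrite (cell_class_char hE tE) scalerA -(linear_part_comp hE gE).
have hgE : signed_perm (p * q)%g (fun j => c j (+) d (p j)) (h \o g).
  by move=> x k; rewrite /= permM hE gE addbA.
by rewrite (cell_class_char hgE (D := D)) // => x; rewrite st tE.
Qed.

Lemma face_inj n i e (s : scube G n.+1) : injective s -> injective (face i e s).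
Proof.
move=> s_inj x y; rewrite !faceE => /s_inj /ffunP h.
by apply/ffunP => k; have := h (lift i k); rewrite !ins_liftE.
Qed.

Lemma bdCW_gen n (D : cw_cell G n.+1) :
  bdCW n (gen D) = - \sum_(i < n.+1) \sum_(e : bool)
    ((-1) ^+ (i + e) : int) *: cell_class (face i e (char_map D)).
Proof.
rewrite [LHS]fglift_gen -sumrN; apply: eq_bigr => i _.
rewrite -[X in X *: _]intz scaler_int.
rewrite (signed_faces (fun e => cell_class (face i e (char_map D)))) -sumrN.
by apply: eq_bigr => e _; rewrite -scaler_int intz.
Qed.

Lemma bdCW_class n (s : scube G n.+1) : injective s ->
  bdCW n (cell_class s) = - \sum_(i < n.+1) \sum_(e : bool)
    ((-1) ^+ (i + e) : int) *: cell_class (face i e s).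
Proof.
move=> s_inj; have [D [p [c [g [gE sD]]]]] := inj_char s_inj.
have [D_inj _ _] := char_mapP D.
rewrite (cell_class_char gE sD) -[X in X *: _]intz scaler_int raddfMz /= bdCW_gen.
rewrite mulNrz; congr (- _); rewrite mulrz_suml (reindex_inj (@perm_inj _ p)) /=.
apply: eq_bigr => i _; rewrite mulrz_suml (reindex_inj (@addIb (c i))) /=.
apply: eq_bigr => e _; have [p' [c' resE]] := restrict_signed gE i e.
have phi_inj := face_inj (i := p i) (e := e (+) c i) D_inj.
rewrite (cell_class_comp (s := face i e s) phi_inj resE) => [|x].
  rewrite -[LHS]scaler_int intz !scalerA; congr (_ *: _).
  rewrite (det_linear_part gE i e) -(signr_odd _ (p i + _)) -(signr_odd _ (i + e)).
  rewrite -(signr_odd _ (i + p i)) !oddD !oddb.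
  set d := \det _; clearbody d; clear resE phi_inj.
  by case: (odd i) (odd (p i)) e (c i) => [] [] [] [];
     rewrite /= ?expr1 ?expr0; ring.
by rewrite !faceE sD (ins_restrict gE).
Qed.

Lemma bdCW_bdCW n (c : CWchain n.+2) : bdCW n (bdCW n.+1 c) = 0.
Proof.
move: c; apply: (freeg_additive0 (h := bdCW n \o bdCW n.+1)) => D /=.
have [D_inj _ _] := char_mapP D.
rewrite bdCW_gen raddfN /= raddf_sum /=.
rewrite -[RHS](face_face_sum (@cell_class n) (char_map D)) /= -sumrN.
apply: eq_bigr => i _; rewrite raddf_sum /= [RHS]exchange_big /= -sumrN.
apply: eq_bigr => e _; rewrite -[X in X *: _]intz scaler_int raddfMz /=.
rewrite (bdCW_class (face_inj (i := i) (e := e) D_inj)) mulNrz opprK mulrz_suml.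
apply: eq_bigr => j _; rewrite mulrz_suml; apply: eq_bigr => e' _.
by rewrite -[X in X *: _]intz scaler_int -mulrzA mulrC.
Qed.

Definition cw_complex : chain_complex := ChainComplex bdCW_bdCW.
End Cellular.

(* Main.v *)
Require Import Defs.
From HB Require Import structures.
From mathcomp Require Import freeg.
From mathcomp Require Import all_boot all_order perm all_algebra zify ring.
From mathcomp Require Import boolp.

Set Implicit Arguments.
Unset Strict Implicit.
Unset Printing Implicit Defensive.

Import GRing.Theory.
Local Open Scope ring_scope.
Local Open Scope quotient_scope.

(* Every singular square is reduced, modulo boundaries and degenerate squares, to
   the chosen parametrisation of a 2-cell.  A noninjective nondegenerate square
   of a triangle-free graph is folded along a diagonal; explicit 3-cubes show that
   it is homologous to 0 or to a combination of backtracking squares, which fill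
   the 1-chains e + (reverse of e).  Explicit 3-cubes also show that an injective
   square changes by the determinant under the symmetries of the square, up to
   folded squares.  Hence collapsing the noninjective cubes induces an
   isomorphism on H_2, provided that it is a chain map: the coefficient of a
   4-cycle Q in the collapsed boundary of a noninjective 3-cube depends only on
   which vertices of the 3-cube are sent to which vertices of Q, and it vanishes
   unless exactly one face is supported by Q, the case excluded by
   quasimonophobicity. *)

(** * Reduction of statements about chains to generators *)

Lemma subrACA (V : zmodType) : @interchange V (fun x y => x - y) (fun x y => x - y).
Proof. by move=> x y z t; rewrite !opprD addrACA -opprD. Qed.

Lemma freeg_additive_closed (K : choiceType) (V : zmodType) (S : zmodClosed V)
    (h : {additive {freeg K / int} -> V}) :
  (forall k, h (gen k) \in S) -> forall c, h c \in S.
Proof.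
move=> h0; elim/freeg_ind_dom0 => [|z k c _ _ hc]; first by rewrite raddf0 rpred0.
have -> : << z *g k >> = gen k *~ z by rewrite /gen freegU_mulz intz.
by rewrite raddfD /= raddfMz rpredD // rpredMz.
Qed.

(** [Dchain] is an intersection of subgroups, and the preimage of [S] under [h] is one of the
    subgroups being intersected. *)
Lemma Dchain_closed (G : sgraph) n (V : zmodType) (S : zmodClosed V)
    (h : {additive Qchain G n -> V}) :
  (forall s : scube G n, degenerate s -> h (gen s) \in S) ->
  forall c, c \in @Dchain G n -> h c \in S.
Proof.
move=> hS c; pose T : {pred Qchain G n} := fun c => h c \in S.
have T_closed : zmod_closed T.
  split; rewrite /T; first by rewrite unfold_in raddf0 rpred0.
  by move=> x y xT yT; rewrite unfold_in raddfB /= rpredB.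
pose T' : zmodClosed _ := HB.pack T (GRing.isZmodClosed.Build _ T T_closed).
by move=> /asboolP /(_ T'); apply=> _ [s [ds ->]]; apply: hS.
Qed.

(** * A criterion for isomorphism in one homological degree *)

Section HomologyIso.
Variables (C D : chain_complex) (n : nat).
(** A map in degree [n.+1] alone is given; its compatibility with the neighbouring degrees enters
    through existence statements, so that no full chain map has to be built. *)
Variable f : {additive chain C n.+1 -> chain D n.+1}.
Hypothesis f_cycle : forall c, bd C n c = 0 -> bd D n (f c) = 0.
Hypothesis f_boundary : forall c, exists d, f (bd C n.+1 c) = bd D n.+1 d.
Hypothesis f_surj : forall z, bd D n z = 0 -> exists2 c, bd C n c = 0 & f c = z.
Hypothesis f_inj : forall c, bd C n c = 0 ->
  (exists d, f c = bd D n.+1 d) -> exists d, c = bd C n.+1 d.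

Fact homology_map_subproof (z : cycles C n.+1) : f (cycle_val z) \in is_cycle (n := n.+1).
Proof. by case: z => c /= /eqP c0; apply/eqP/f_cycle. Qed.

Definition cycle_map (z : cycles C n.+1) : cycles D n.+1 :=
  Cycles (homology_map_subproof z).

Definition homology_map (x : homology C n.+1) : homology D n.+1 :=
  \pi_(Quotient.quot (@is_boundary D n.+1)) (cycle_map (repr x)).

Lemma homology_map_pi (z : cycles C n.+1) :
  homology_map (\pi_(Quotient.quot (@is_boundary C n.+1)) z) =
  \pi_(Quotient.quot (@is_boundary D n.+1)) (cycle_map z).
Proof.
apply/eqP; rewrite -Quotient.idealrBE; set y := repr _.
have : y - z \in @is_boundary C n.+1.
  by rewrite Quotient.idealrBE reprK.
move=> /asboolP[c cE]; apply/asboolP; have [d dE] := f_boundary c.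
by exists d; rewrite -dE cE !raddfB.
Qed.

Lemma homology_map_is_additive : zmod_morphism homology_map.
Proof.
move=> x y; rewrite -[x]reprK -[y]reprK -raddfB /= !homology_map_pi.
rewrite -raddfB /=; congr (\pi _); apply/val_inj => /=.
by rewrite raddfB.
Qed.
HB.instance Definition _ :=
  GRing.isZmodMorphism.Build _ _ homology_map homology_map_is_additive.

Lemma homology_iso : isomorphic (homology C n.+1) (homology D n.+1).
Proof.
exists homology_map.
have inj : injective homology_map.
  move=> x y /eqP; rewrite -subr_eq0 -raddfB /= => xy0.
  apply/eqP; rewrite -subr_eq0; move: xy0; rewrite -{1}[x - y]reprK homology_map_pi.
  have pi0 (E : chain_complex) (z : cycles E n.+1) :
      (\pi_(Quotient.quot (@is_boundary E n.+1)) z == 0) = (z \in @is_boundary E n.+1).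
    by rewrite -(raddf0 (\pi_(Quotient.quot (@is_boundary E n.+1)))) -Quotient.idealrBE subr0.
  rewrite pi0 => /asboolP[d dE]; rewrite -[x - y]reprK pi0; apply/asboolP.
  have c0 : bd C n (cycle_val (repr (x - y))) = 0.
    by case: (repr (x - y)) => c /= /eqP.
  have [|e eE] := f_inj c0; first by exists d.
  by exists e.
have surj y : exists x, homology_map x = y.
  have z0 : bd D n (cycle_val (repr y)) = 0 by case: (repr y) => c /= /eqP.
  have [c c0 cE] := f_surj z0.
  have cc : c \in is_cycle (n := n.+1) (C := C) by apply/eqP.
  exists (\pi_(Quotient.quot (@is_boundary C n.+1)) (Cycles cc)).
  by rewrite homology_map_pi -[RHS]reprK; congr (\pi _); apply/val_inj.
have [g gE] := choice surj; exists g => // x; exact: inj (gE _).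
Qed.
End HomologyIso.

(** * Explicit singular cubes of dimension at most 3 *)

Section SmallCubes.
Variable G : sgraph.
Implicit Types (u v : G) (f : bool -> bool -> G) (g : bool -> bool -> bool -> G).

Definition near u v := adj u v \/ u = v.

Lemma near_refl u : near u u. Proof. by right. Qed.

Lemma near_sym u v : near u v -> near v u.
Proof. by case=> [uv|->]; [left; rewrite adj_sym | right]. Qed.

Fact const_cube_subproof n u :
  `[< @graph_map (cube_graph n) G [ffun=> u] >].
Proof. by apply/asboolP => x y _; right; rewrite !ffunE. Qed.

Definition const_cube n u : scube G n := SCube (const_cube_subproof n u).

(* Constant if [f] is not a graph map. *)
Definition mkcube n (f : cube n -> G) : scube G n :=
  insubd (const_cube n (f [ffun=> false])) (finfun f).

Lemma mkcubeE n (f : cube n -> G) :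
  (forall x j, near (f x) (f (flip j x))) -> forall x, mkcube f x = f x.
Proof.
move=> lipf x; rewrite /mkcube /insubd insubT /= ?ffunE //.
by apply/asboolP => {x} x y /cube_adjP[j ->]; rewrite !ffunE; apply: lipf.
Qed.

Lemma near_flip n (s : scube G n) x j : near (s x) (s (flip j x)).
Proof. by apply: (scubeP s); apply/cube_adjP; exists j. Qed.

Lemma mkcube_eta n (s : scube G n) : mkcube s = s.
Proof. by apply/val_inj/ffunP => x; apply: mkcubeE; apply: near_flip. Qed.

Definition o20 : 'I_2 := ord0.
Definition o21 : 'I_2 := ord_max.
Definition o30 : 'I_3 := ord0.
Definition o31 : 'I_3 := @Ordinal 3 1 isT.
Definition o32 : 'I_3 := ord_max.

Lemma ord2P (P : 'I_2 -> Prop) : P o20 -> P o21 -> forall i, P i.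
Proof.
by move=> P0 P1 [[|[|//]] lt_i]; [move: P0|move: P1]; congr P; apply/val_inj.
Qed.

Lemma ord3P (P : 'I_3 -> Prop) : P o30 -> P o31 -> P o32 -> forall i, P i.
Proof.
by move=> P0 P1 P2 [[|[|[|//]]] lt_i]; [move: P0|move: P1|move: P2];
  congr P; apply/val_inj.
Qed.

Definition pt n (l : seq bool) : cube n := [ffun k : 'I_n => nth false l k].

(** For a concrete index the right-hand side computes to a list of coordinates, so faces of explicit
    cubes are found by rewriting. *)
Lemma pt_ins n (i : 'I_n.+1) e (l : seq bool) : size l = n ->
  ins i e (pt n l) = pt n.+1 (take i l ++ e :: drop i l).
Proof.
move=> ln; have size_i : size (take i l) = i by rewrite size_takel // ln -ltnS.
apply/ffunP => k; rewrite [RHS]ffunE nth_cat size_i.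
have [j ->|->] := unliftP i k; last by rewrite insE ltnn subnn.
rewrite ins_liftE ffunE /= /bump; case: (leqP i j) => ij /=.
  by rewrite add1n ltnNge ltnW //= subSn //= nth_drop subnKC.
by rewrite add0n ij nth_take.
Qed.

Lemma pt1_eta (x : cube 1) : x = pt 1 [:: x ord0].
Proof. by apply/ffunP => k; rewrite ffunE ord1. Qed.

Lemma pt2_eta (x : cube 2) : x = pt 2 [:: x o20; x o21].
Proof. by apply/ffunP; apply: ord2P; rewrite ffunE. Qed.

Lemma pt3_eta (x : cube 3) : x = pt 3 [:: x o30; x o31; x o32].
Proof. by apply/ffunP; apply: ord3P; rewrite ffunE. Qed.

Definition edge u v : scube G 1 := mkcube (fun x => if x ord0 then v else u).
Definition square f : scube G 2 := mkcube (fun x => f (x o20) (x o21)).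
Definition solid g : scube G 3 := mkcube (fun x => g (x o30) (x o31) (x o32)).

(** The graph-map condition for a curried map: first the edges that vary the first coordinate, then
    those that vary the second. *)
Definition lip2 f :=
  (forall y, near (f false y) (f true y)) /\ (forall x, near (f x false) (f x true)).
Definition lip3 g :=
  [/\ forall y z, near (g false y z) (g true y z),
      forall x z, near (g x false z) (g x true z)
    & forall x y, near (g x y false) (g x y true)].

Lemma edgeE u v b : near u v -> edge u v (pt 1 [:: b]) = if b then v else u.
Proof.
move=> uv; rewrite mkcubeE ?ffunE // => x j; rewrite ffunE !ord1.
by case: (x _) => /=; [apply: near_sym|].
Qed.

Lemma squareE f x y : lip2 f -> square f (pt 2 [:: x; y]) = f x y.
Proof.
case=> f1 f2; rewrite mkcubeE ?ffunE // => p; apply: ord2P; rewrite !ffunE /= ?addbF ?addbT.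
  by case: (p o20) => /=; [apply: near_sym|].
by case: (p o21) => /=; [apply: near_sym|].
Qed.

Lemma solidE g x y z : lip3 g -> solid g (pt 3 [:: x; y; z]) = g x y z.
Proof.
case=> f1 f2 f3; rewrite mkcubeE ?ffunE // => p; apply: ord3P; rewrite !ffunE /= ?addbF ?addbT.
- by case: (p o30) => /=; [apply: near_sym|].
- by case: (p o31) => /=; [apply: near_sym|].
by case: (p o32) => /=; [apply: near_sym|].
Qed.

Lemma edge_eta (s : scube G 1) : s = edge (s (pt 1 [:: false])) (s (pt 1 [:: true])).
Proof.
rewrite -[LHS]mkcube_eta; congr mkcube; apply/funext => x.
by rewrite {1}[x]pt1_eta; case: (x _).
Qed.

Lemma square_eta (s : scube G 2) : s = square (fun x y => s (pt 2 [:: x; y])).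
Proof.
by rewrite -[LHS]mkcube_eta; congr mkcube; apply/funext => x; rewrite {1}[x]pt2_eta.
Qed.

Lemma scube_near_edge (s : scube G 1) : near (s (pt 1 [:: false])) (s (pt 1 [:: true])).
Proof.
have -> : pt 1 [:: true] = flip ord0 (pt 1 [:: false]).
  by apply/ffunP => k; rewrite !ffunE !ord1.
exact: near_flip.
Qed.

Lemma scube_lip2 (s : scube G 2) : lip2 (fun x y => s (pt 2 [:: x; y])).
Proof.
split=> b.
  have -> : pt 2 [:: true; b] = flip o20 (pt 2 [:: false; b]).
    by apply/ffunP; apply: ord2P; rewrite !ffunE /= ?addbF.
  exact: near_flip.
have -> : pt 2 [:: b; true] = flip o21 (pt 2 [:: b; false]).
  by apply/ffunP; apply: ord2P; rewrite !ffunE /= ?addbF.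
exact: near_flip.
Qed.

Lemma edge_ext (s : scube G 1) u v : near u v ->
  (s (pt 1 [:: false]) = u) -> s (pt 1 [:: true]) = v -> s = edge u v.
Proof. by move=> uv su sv; rewrite [s]edge_eta su sv. Qed.

Lemma square_ext f f' : f =2 f' -> square f = square f'.
Proof. by move=> ff'; congr square; apply/funext => x; apply/funext => y. Qed.

Lemma face_square f : lip2 f -> forall e,
  face o20 e (square f) = edge (f e false) (f e true) /\
  face o21 e (square f) = edge (f false e) (f true e).
Proof.
move=> lf e; have [f1 f2] := lf.
by split; apply: edge_ext; rewrite // faceE pt_ins // squareE.
Qed.

Lemma face_solid g : lip3 g -> forall e,
  [/\ face o30 e (solid g) = square (fun y z => g e y z),
      face o31 e (solid g) = square (fun x z => g x e z)
    & face o32 e (solid g) = square (fun x y => g x y e)].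
Proof.
move=> lg e; split; rewrite [LHS]square_eta; apply: square_ext => x y;
  by rewrite faceE pt_ins // solidE.
Qed.

Lemma bdQ_square f : lip2 f ->
  bdQ G 1 (gen (square f)) =
  - (gen (edge (f false false) (f false true)) -
     gen (edge (f true false) (f true true))) +
  (gen (edge (f false false) (f true false)) -
   gen (edge (f false true) (f true true))).
Proof.
move=> lf; rewrite bdQ_gen big_ord_recl big_ord1 /= expr1 sqrrN expr1n scaleN1r scale1r.
rewrite (_ : lift _ _ = o21); last exact/val_inj.
by rewrite !(proj1 (face_square lf _)) !(proj2 (face_square lf _)).
Qed.

Lemma bdQ_solid g : lip3 g ->
  bdQ G 2 (gen (solid g)) =
  - (gen (square (g false)) - gen (square (g true))) +
  (gen (square (fun x => g x false)) - gen (square (fun x => g x true))) -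
  (gen (square (fun x y => g x y false)) - gen (square (fun x y => g x y true))).
Proof.
move=> lg; rewrite bdQ_gen !big_ord_recl big_ord0 addr0 /= expr1.
rewrite (_ : (-1) ^+ _ = 1 :> int) //.
rewrite (_ : (-1) ^+ _ = -1 :> int) //.
rewrite scale1r !scaleN1r addrA.
rewrite (_ : lift ord0 ord0 = o31); last exact/val_inj.
rewrite (_ : lift ord0 _ = o32); last exact/val_inj.
have [-> -> ->] := face_solid lg false.
by have [-> -> ->] := face_solid lg true.
Qed.
End SmallCubes.

(** * Null-homologous squares, the homotopy on edges, and the collapsing map *)

Local Notation "[ 'sq' f ]" := (gen (square f) : Qchain _ 2) (format "[ 'sq'  f ]").

(** The cubes treated by these tactics arise from a square [f] by substituting Boolean expressions
    for its coordinates. Each of their edges is constant, is an edge of [f] or its reverse, or joins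
    two corners that are equal by hypothesis. *)
Ltac near_tac lf :=
  case: (lf) => /[dup] /(_ false) ? /(_ true) ? /[dup] /(_ false) ? /(_ true) ?;
  by [assumption | apply: near_refl | apply: near_sym; assumption | right].
Ltac lip2_tac lf := split=> -[]; rewrite /=; near_tac lf.
Ltac lip3_tac lf := split=> -[] []; rewrite /=; near_tac lf.

Section Boundaries.
Variable G : sgraph.
Implicit Types (u v : G) (f : bool -> bool -> G).

(** Membership means being a boundary in the quotient by degenerate chains. Stating it as a subgroup
    of [Qchain] avoids representatives of classes. *)
Definition null_homologous n : {pred Qchain G n} :=
  fun c => `[< exists d, c - bdQ G n d \in @Dchain G n >].

Fact null_homologous_closed n : zmod_closed (@null_homologous n).
Proof.
split; first by apply/asboolP; exists 0; rewrite raddf0 subrr rpred0.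
move=> x y /asboolP[c cx] /asboolP[d dy]; apply/asboolP; exists (c - d).
by rewrite raddfB !opprD !opprK addrACA -[- y + _]opprK opprD opprK rpredB.
Qed.
HB.instance Definition _ n :=
  GRing.isZmodClosed.Build _ (@null_homologous n) (@null_homologous_closed n).

Lemma null_homologous_bd n d : bdQ G n d \in @null_homologous n.
Proof. by apply/asboolP; exists d; rewrite subrr rpred0. Qed.

Lemma null_homologous_Dchain n c : c \in @Dchain G n -> c \in @null_homologous n.
Proof. by move=> cD; apply/asboolP; exists 0; rewrite raddf0 subr0. Qed.

Notation null := (@null_homologous 2).

Lemma square_degenerate1 f : lip2 f -> (forall y, f false y = f true y) ->
  degenerate (square f).
Proof.
move=> lf f01; exists o20.
by rewrite !(proj1 (face_square lf _)) !f01.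
Qed.

Lemma square_degenerate2 f : lip2 f -> (forall x, f x false = f x true) ->
  degenerate (square f).
Proof.
move=> lf f01; exists o21.
by rewrite !(proj2 (face_square lf _)) !f01.
Qed.

Lemma null_square1 f : lip2 f -> (forall y, f false y = f true y) -> [sq f] \in null.
Proof. by move=> *; apply/null_homologous_Dchain/Dchain_gen/square_degenerate1. Qed.

Lemma null_square2 f : lip2 f -> (forall x, f x false = f x true) -> [sq f] \in null.
Proof. by move=> *; apply/null_homologous_Dchain/Dchain_gen/square_degenerate2. Qed.

(** Source of all homologies between squares below: a 3-cube [g] is chosen so that the unwanted
    faces are degenerate, cancel in pairs or are already known. *)
Lemma null_solid (g : bool -> bool -> bool -> G) : lip3 g ->
  - ([sq g false] - [sq g true]) +
  ([sq fun x => g x false] - [sq fun x => g x true]) -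
  ([sq fun x y => g x y false] - [sq fun x y => g x y true]) \in null.
Proof. by move=> lg; rewrite -bdQ_solid // null_homologous_bd. Qed.

(* [f x y] is the point x + y of a path of length 2.  The two 3-cubes are
   max (0, x + y - z) and max (0, x + y - 1 - z) along it; both are symmetric in
   x and y, so that their boundaries reduce to the faces z = 0 and z = 1. *)
Lemma null_antidiagonal f : lip2 f -> f false true = f true false -> [sq f] \in null.
Proof.
move=> lf f01.
pose g1 x y z := if z then f (x && y) false else f x y.
have lg1 : lip3 g1 by rewrite /g1; lip3_tac lf.
pose g2 x y (z : bool) := if z then f false false else f (x && y) false.
have lg2 : lip3 g2 by rewrite /g2; lip3_tac lf.
have := null_solid lg1; have := null_solid lg2.
have sym1 e : square (fun x => g1 x e) = square (g1 e).
  by apply: square_ext; rewrite /g1; case: e => [] [] [].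
have sym2 e : square (fun x => g2 x e) = square (g2 e).
  by apply: square_ext; rewrite /g2; case: e => [] [] [].
rewrite !sym1 !sym2 !addNr !add0r !rpredN /g1 /g2.
have n0 : [sq fun _ _ => f false false] \in null.
  by apply: null_square1 => //; split=> *; apply: near_refl.
by rewrite (rpredBr _ n0) => n1; rewrite (rpredBr _ n1).
Qed.

(** Only the corner (1,0) goes to [v], so modulo degenerate edges the boundary is the edge from [u]
    to [v] plus its reverse. *)
Definition backtrack u v x y := if x && ~~ y then v else u.

Lemma lip2_backtrack u v : near u v -> lip2 (backtrack u v).
Proof.
by move=> uv; split=> -[] /=; (exact: near_refl || exact: near_sym || exact: uv).
Qed.

(** The 3-cube deforms [y] into [x && y]. The face [z = 0] is [f], and the faces [x = 0] and [z = 1]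
    are the two backtracks. The face [y = 1] is folded along the other diagonal, and the remaining
    two are degenerate. *)
Lemma null_diagonal f : lip2 f -> f false false = f true true ->
  [sq f] - ([sq backtrack (f false false) (f true false)] -
            [sq backtrack (f false false) (f false true)]) \in null.
Proof.
move=> lf f00.
pose g x y z := f x (if z then x && y else y).
have lg : lip3 g by rewrite /g; lip3_tac lf.
have := null_solid lg.
rewrite (square_ext (f := g false) (f' := backtrack (f false false) (f false true))); last by do 2!case.
rewrite (square_ext (f := fun x y => g x y true) (f' := backtrack (f false false) (f true false))); last first.
  by rewrite /g /backtrack; do 2!case.
have n1 : [sq g true] \in null by rewrite /g; apply: null_square2 => //; lip2_tac lf.
have n2 : [sq fun x => g x false] \in null.
  by rewrite /g; apply: null_square2 => [|x]; [lip2_tac lf | rewrite andbF].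
have n3 : [sq fun x => g x true] \in null.
  by apply: null_antidiagonal => //; rewrite /g /=; lip2_tac lf.
rewrite addrAC (rpredDr _ (rpredB n2 n3)) opprB -addrA (rpredDl _ n1).
by rewrite -opprD rpredN addrCA opprB.
Qed.

(** The two squares are opposite faces of a 3-cube whose other four faces are degenerate or have
    equal corners (0,1) and (1,0). *)
Lemma null_backtrack_sym u v : near u v ->
  [sq backtrack u v] - [sq backtrack v u] \in null.
Proof.
move=> uv; have vu := near_sym uv.
pose g x y z := if z then backtrack v u x y else backtrack u v x y.
have lg : lip3 g.
  by split=> -[] [] /=; (exact: near_refl || exact: uv || exact: vu).
have slice2 (f : bool -> bool -> G) :
    (forall x y, f x y = u \/ f x y = v) -> lip2 f.
  move=> fuv; have n x y x' y' : near (f x y) (f x' y').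
    by case: (fuv x y) => ->; case: (fuv x' y') => ->; (exact: near_refl || exact: uv || exact: vu).
  by split.
have guv x y z : g x y z = u \/ g x y z = v.
  by case: x y z => [] [] []; rewrite /g /backtrack /=; tauto.
have n1 : [sq g false] \in null.
  by apply: null_square1 => // ; apply: slice2.
have n2 : [sq g true] \in null.
  by apply: null_antidiagonal => //; apply: slice2.
have n3 : [sq fun x => g x false] \in null.
  by apply: null_antidiagonal => //; apply: slice2.
have n4 : [sq fun x => g x true] \in null.
  by apply: null_square1 => [|[]] //; apply: slice2.
have := null_solid lg; rewrite addrC rpredDr ?rpredN //.
by rewrite rpredD ?rpredN // rpredB.
Qed.

Definition char_edge (s : scube G 1) := `[< exists D, s = char_map D >].

(* An edge traversed against the orientation given by [char_map] is sent to the
   backtracking square that bounds the sum of this edge and its reverse. *)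
Definition htpy : {additive Qchain G 1 -> Qchain G 2} :=
  fglift (fun s : scube G 1 => if char_edge s then 0
          else [sq backtrack (s (pt 1 [:: true])) (s (pt 1 [:: false]))] : Qchain G 2).

Lemma htpy_gen s : htpy (gen s) = if char_edge s then 0
   else [sq backtrack (s (pt 1 [:: true])) (s (pt 1 [:: false]))].
Proof. exact: fglift_gen. Qed.

Lemma htpy_edge u v : near u v -> htpy (gen (edge u v)) =
  if char_edge (edge u v) then 0 else [sq backtrack v u].
Proof. by move=> uv; rewrite htpy_gen !edgeE. Qed.

Lemma degenerate_edge (s : scube G 1) :
  degenerate s -> s (pt 1 [:: false]) = s (pt 1 [:: true]).
Proof.
case=> i; rewrite ord1 => e; have := congr1 (fun t : scube G 0 => t (pt 0 [::])) e.
by rewrite !faceE !pt_ins.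
Qed.

Lemma degenerate_edge_refl u : degenerate (edge u u).
Proof.
exists ord0; apply/val_inj/ffunP => x; rewrite !faceE.
have -> : x = pt 0 [::] by apply/ffunP => -[].
by rewrite !pt_ins // !edgeE //; apply: near_refl.
Qed.

Lemma htpy_degenerate c : c \in @Dchain G 1 -> htpy c \in null.
Proof.
apply: Dchain_closed => s ds; rewrite htpy_gen; case: ifP => _; first exact: rpred0.
rewrite (degenerate_edge ds); set u := s _.
apply: null_square1 => [|y]; last by rewrite /backtrack /=; case: y.
exact/lip2_backtrack/near_refl.
Qed.

Lemma degenerate_noninj n (s : scube G n) : degenerate s -> ~ injective s.
Proof.
case: n s => // n s [i si] s_inj.
have := congr1 (fun t : scube G n => t [ffun=> false]) si.
by rewrite !faceE => /s_inj /ffunP /(_ i); rewrite !insE.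
Qed.

Lemma edge_inj u v : adj u v -> injective (edge u v).
Proof.
move=> uv x y; rewrite [x]pt1_eta [y]pt1_eta; have nuv : near u v by left.
rewrite !edgeE //; case: (x _) (y _) => [] [] // e; by rewrite e adj_irr in uv.
Qed.

(** The comparison map with cellular chains. It kills all noninjective cubes, in particular the
    degenerate ones; its compatibility with the boundary is what the hypotheses on the graph
    provide. *)
Definition collapse n : {additive Qchain G n -> CWchain G n} :=
  fglift (fun s : scube G n => if `[< injective s >] then cell_class s else 0).

Lemma collapse_inj n (s : scube G n) : injective s -> collapse n (gen s) = cell_class s.
Proof. by move=> s_inj; rewrite [LHS]fglift_gen asboolT. Qed.

Lemma collapse_noninj n (s : scube G n) : ~ injective s -> collapse n (gen s) = 0.
Proof. by move=> s_inj; rewrite [LHS]fglift_gen asboolF. Qed.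

Lemma collapse_degenerate n c : c \in @Dchain G n -> collapse n c = 0.
Proof.
pose S : {pred CWchain G n} := fun c => c == 0.
have S_closed : zmod_closed S.
  split; rewrite /S; first by rewrite unfold_in.
  by move=> x y /eqP-> /eqP->; rewrite unfold_in subrr.
pose S' : zmodClosed _ := HB.pack S (GRing.isZmodClosed.Build _ S S_closed).
move=> cD; apply/eqP; apply: (Dchain_closed (S := S') (h := collapse n)) cD => s ds.
by rewrite collapse_noninj ?rpred0 //; apply: degenerate_noninj.
Qed.

Lemma cell_class_char_map n (D : cw_cell G n) : cell_class (char_map D) = gen D.
Proof.
rewrite (@cell_class_char G n _ D 1%g (fun=> false) id) => //; last first.
  by move=> x j; rewrite perm1 addbF.
rewrite (_ : linear_part id = 1%:M) ?det1 ?scale1r //.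
apply/matrixP => i j; rewrite (@linear_part_signed n 1%g (fun=> false)).
  by rewrite perm1 mulr1 mxE.
by move=> x k; rewrite perm1 addbF.
Qed.

Definition edge_cell (u v : G) D :=
  [/\ edge u v = char_map D, ~~ char_edge (edge v u) &
   cell_class (edge v u) = - gen D].

(** An edge differs from the characteristic map of its cell by an automorphism of [I^1], that is, by
    the identity or the flip; the sign [c] tells which. *)
Lemma adj_edge_cell u v : adj u v -> exists D, edge_cell u v D \/ edge_cell v u D.
Proof.
move=> uv; have nuv : near u v by left.
have [D [p [c [g [gE uvD]]]]] := inj_char (edge_inj uv).
have [D_inj _ _] := char_mapP D.
(* The reverse of a characteristic edge is its composite with the flip, of determinant -1. Having
   the same image, it could only be characteristic for the same cell, and then its endpoints would
   coincide. *)
have main u' v' : adj u' v' -> edge u' v' = char_map D -> edge_cell u' v' D.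
  move=> uv' e; have nuv' : near u' v' by left.
  have gE' : signed_perm 1%g (fun=> true) (flip (ord0 : 'I_1)).
    by move=> x j; rewrite perm1 ffunE !ord1.
  have vuD x : edge v' u' x = char_map D (flip ord0 x).
    rewrite -e [x]pt1_eta (_ : flip _ _ = pt 1 [:: ~~ x ord0]).
      by rewrite !edgeE //; [case: (x _) | apply: near_sym].
    by apply/ffunP => k; rewrite !ffunE !ord1 /= addbT.
  split=> //.
    apply/asboolP => -[D' eD'].
    have DD' : D = D'.
      apply/val_inj; rewrite /= -(iso_image (char_mapP D)) -(iso_image (char_mapP D')).
      by rewrite -eD' (image_comp gE' vuD).
    rewrite -{}DD' -{}e in eD'.
    have := congr1 (fun s : scube G 1 => s (pt 1 [:: false])) eD'.
    rewrite !edgeE //=; last exact: near_sym.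
    by move=> vu; rewrite vu adj_irr in uv'.
  rewrite (cell_class_char gE' vuD) det_mx11 (linear_part_signed gE').
  by rewrite perm1 mul1r scaleN1r.
exists D; have [c0|c0] := boolP (c ord0); [right|left]; apply: main => //.
- by rewrite adj_sym.
- symmetry; apply: edge_ext; first exact: near_sym.
  + have := uvD (pt 1 [:: true]); rewrite edgeE //= => ->; congr (char_map D _).
    by apply/ffunP => k; have := gE (pt 1 [:: true]) ord0; rewrite !ord1 c0 !ffunE => ->.
  + have := uvD (pt 1 [:: false]); rewrite edgeE //= => ->; congr (char_map D _).
    by apply/ffunP => k; have := gE (pt 1 [:: false]) ord0; rewrite !ord1 c0 !ffunE => ->.
symmetry; apply: edge_ext => //.
+ have := uvD (pt 1 [:: false]); rewrite edgeE //= => ->; congr (char_map D _).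
  by apply/ffunP => k; have := gE (pt 1 [:: false]) ord0; rewrite !ord1 (negPf c0) !ffunE => ->.
+ have := uvD (pt 1 [:: true]); rewrite edgeE //= => ->; congr (char_map D _).
  by apply/ffunP => k; have := gE (pt 1 [:: true]) ord0; rewrite !ord1 (negPf c0) !ffunE => ->.
Qed.
End Boundaries.

(** * Correction of squares by the homotopy, and the symmetries of the square *)

Section Squares.
Variable G : sgraph.
Implicit Types (u v : G) (f : bool -> bool -> G).

Notation null := (@null_homologous G 2).

(** Exactly one of a nonconstant edge and its reverse is characteristic, so [htpy] yields a single
    backtrack, either [backtrack v u] or [backtrack u v]; these are homologous. For [u = v] every
    term is degenerate. *)
Lemma htpy_edge_sym u v : near u v ->
  htpy G (gen (edge u v) + gen (edge v u)) - [sq backtrack v u] \in null.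
Proof.
move=> uv; have vu := near_sym uv; rewrite raddfD /= !htpy_edge //.
case: uv => [uv|<-]; last first.
  have n1 : [sq backtrack u u] \in null.
    by apply: null_square1 => [|[]//]; apply/lip2_backtrack/near_refl.
  by case: ifP => _; rewrite ?addr0 ?add0r ?subrr ?addrK ?rpredN // rpred0.
have [D [[e1 e2 _]|[e1 e2 _]]] := adj_edge_cell uv.
  rewrite [char_edge (edge u v)]asboolT; last by exists D.
  rewrite (negPf e2) add0r; apply: null_backtrack_sym; exact: near_sym.
rewrite [char_edge (edge v u)]asboolT; last by exists D.
by rewrite (negPf e2) addr0 subrr rpred0.
Qed.

Lemma collapse_edge_sym u v : near u v ->
  collapse G 1 (gen (edge u v) + gen (edge v u)) = 0.
Proof.
case=> [uv|<-]; rewrite raddfD /=; last first.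
  by rewrite collapse_noninj ?addr0 //; apply/degenerate_noninj/degenerate_edge_refl.
have vu : adj v u by rewrite adj_sym.
rewrite !collapse_inj; try exact: edge_inj.
have [D [[-> _ ->]|[-> _ ->]]] := adj_edge_cell uv; rewrite cell_class_char_map.
  by rewrite subrr.
by rewrite addNr.
Qed.

Definition cell_lift1 : {additive CWchain G 1 -> Qchain G 1} :=
  fglift (fun D : cw_cell G 1 => gen (char_map D) : Qchain G 1).

Lemma cell_lift1_gen D : cell_lift1 (gen D) = gen (char_map D).
Proof. exact: fglift_gen. Qed.

Lemma bdQ_backtrack u v : near u v -> bdQ G 1 [sq backtrack u v] =
  - (gen (edge u u) - gen (edge v u)) + (gen (edge u v) - gen (edge u u)).
Proof. by move=> uv; rewrite bdQ_square //; apply: lip2_backtrack. Qed.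

(** Together with zero in degree 0, [htpy] is a chain homotopy in degree 1 from the identity to
    [cell_lift1] after [collapse], modulo degenerate edges. *)
Lemma htpy1_gen (s : scube G 1) :
  gen s - bdQ G 1 (htpy G (gen s)) - cell_lift1 (collapse G 1 (gen s)) \in @Dchain G 1.
Proof.
have uv := scube_near_edge s; rewrite [s]edge_eta; move: uv; set u := s _; set v := s _ => uv.
rewrite htpy_edge //; have [/asboolP[D uvD]|nchar] := boolP (char_edge (edge u v)).
  have [D_inj _ _] := char_mapP D.
  rewrite uvD raddf0 subr0 collapse_inj // cell_class_char_map cell_lift1_gen.
  by rewrite subrr rpred0.
have dv : gen (edge v v) \in @Dchain G 1 by apply/Dchain_gen/degenerate_edge_refl.
rewrite bdQ_backtrack; last exact: near_sym.
case: uv nchar => [uv nchar|-> _]; last first.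
  rewrite collapse_noninj; last by apply: degenerate_noninj; apply: degenerate_edge_refl.
  by rewrite raddf0 subr0 subrr oppr0 addr0 subr0.
rewrite collapse_inj; last exact: edge_inj.
have [D [[e1 _ _]|[e1 _ ->]]] := adj_edge_cell uv.
  by case/asboolP: nchar; exists D.
rewrite raddfN /= cell_lift1_gen e1 opprK opprB opprD !opprB.
rewrite -addrA; set a := gen (edge u v); set b := gen (char_map D); set c := gen _ in dv *.
(* What remains is twice the constant edge at [v], coming from the two constant sides of the
   backtrack. *)
rewrite (_ : _ + _ = c *+ 2) ?rpredMn // mulr2n.
by rewrite -[c - a + _ + b]addrA subrK addrA [a + _]addrC subrK.
Qed.

Lemma htpy1 c :
  c - bdQ G 1 (htpy G c) - cell_lift1 (collapse G 1 c) \in @Dchain G 1.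
Proof.
pose r := (idfun \- (bdQ G 1 \o htpy G) \- (cell_lift1 \o collapse G 1)).
exact: (freeg_additive_closed (S := @Dchain G 1) (h := r)) htpy1_gen c.
Qed.

(** By [htpy1], the boundary of a corrected square is, modulo degenerate edges, a combination of
    characteristic edges. On cycles modulo degenerate chains the correction term is
    null-homologous. *)
Definition contract : {additive Qchain G 2 -> Qchain G 2} :=
  idfun \- (htpy G \o bdQ G 1).

Lemma contract_Dchain c : c \in @Dchain G 2 -> contract c \in null.
Proof.
move=> cD; apply: rpredB; first exact: null_homologous_Dchain.
by apply/htpy_degenerate/bdQ_Dchain.
Qed.

Lemma contract_null c : c \in null -> contract c \in null.
Proof.
move=> /asboolP[d cd]; rewrite -[c](subrK (bdQ G 2 d)) raddfD /= rpredD //.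
  exact: contract_Dchain.
by rewrite /= bdQ_bdQ raddf0 subr0 null_homologous_bd.
Qed.

Definition folded f :=
  f false false = f true true \/ f false true = f true false.

Lemma bdQ_diagonal f : lip2 f -> f false false = f true true ->
  bdQ G 1 [sq f] =
  (gen (edge (f true false) (f false false)) + gen (edge (f false false) (f true false))) -
  (gen (edge (f false true) (f false false)) + gen (edge (f false false) (f false true))).
Proof.
move=> lf ff; rewrite bdQ_square // -ff opprB addrACA -opprD.
by rewrite [gen (edge _ (f false true)) + _]addrC.
Qed.

Lemma bdQ_antidiagonal f : lip2 f -> f false true = f true false ->
  bdQ G 1 [sq f] = 0.
Proof. by move=> lf ff; rewrite bdQ_square // ff addNr. Qed.

(** If the corners (0,0) and (1,1) agree, [htpy] of the boundary is homologous to the difference of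
    backtracks in [null_diagonal], and the two cancel. In the other case the boundary vanishes and
    the square itself is null-homologous. *)
Lemma contract_folded f : lip2 f -> folded f -> contract [sq f] \in null.
Proof.
move=> lf; have [f1 f2] := lf; case=> ff.
  have := null_diagonal lf ff; rewrite /contract /= bdQ_diagonal //.
  rewrite [htpy G _]raddfB => n1.
  have bc : near (f false false) (f true false) by apply: f1.
  have ba : near (f false false) (f false true) by apply: f2.
  have n2 := htpy_edge_sym (near_sym bc); have n3 := htpy_edge_sym (near_sym ba).
  have := rpredB n2 n3; rewrite subrACA => n4.
  by have := rpredB n1 n4; rewrite [- (_ - (_ - _))]opprB subrKA.
by rewrite /contract /= bdQ_antidiagonal // raddf0 subr0 null_antidiagonal.
Qed.

Lemma contract_degenerate f : lip2 f -> degenerate (square f) -> contract [sq f] \in null.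
Proof. by move=> lf df; apply/contract_Dchain/Dchain_gen. Qed.

Lemma contract_square1 f : lip2 f -> (forall y, f false y = f true y) ->
  contract [sq f] \in null.
Proof. by move=> *; apply: contract_degenerate => //; apply: square_degenerate1. Qed.

Lemma contract_solid (g : bool -> bool -> bool -> G) : lip3 g ->
  - (contract [sq g false] - contract [sq g true]) +
  (contract [sq fun x => g x false] - contract [sq fun x => g x true]) -
  (contract [sq fun x y => g x y false] - contract [sq fun x y => g x y true]) \in null.
Proof.
by move=> lg; rewrite -!raddfB -raddfN -raddfD -raddfB; apply/contract_null/null_solid.
Qed.

(** The square and its reflection are the faces [x = 0] and [y = 1] of [g]; the faces in the
    direction [z] are folded and the other two degenerate. *)
Lemma contract_reflect f : lip2 f ->
  contract [sq f] + contract [sq fun x => f (~~ x)] \in null.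
Proof.
move=> lf; pose g x y z := f (y && ~~ x) z.
have lg : lip3 g by rewrite /g; lip3_tac lf.
have := contract_solid lg.
rewrite (square_ext (f := g false) (f' := f)); last by case.
rewrite (square_ext (f := fun x => g x true) (f' := fun x => f (~~ x))) //.
have n1 : contract [sq g true] \in null.
  by apply: contract_square1 => [|y]; rewrite /g; [lip2_tac lf | rewrite andbF].
have n2 : contract [sq fun x => g x false] \in null.
  by rewrite /g; apply: contract_square1 => //; lip2_tac lf.
have n3 z : contract [sq fun x y => g x y z] \in null.
  by apply: contract_folded; [case: z; rewrite /g; lip2_tac lf | left].
rewrite (rpredBr _ (rpredB (n3 false) (n3 true))).
by rewrite opprB -addrA (rpredDl _ n1) addrCA (rpredDl _ n2) -opprD rpredN.
Qed.

(** A quarter turn moves each corner of the square to a neighbouring corner, so the square and its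
    rotation are opposite faces of a 3-cube. The four side faces are folded. *)
Lemma contract_rotate f : lip2 f ->
  contract [sq f] - contract [sq fun x y => f y (~~ x)] \in null.
Proof.
move=> lf; pose g x y z := if x then f z (~~ y) else f y z.
have lg : lip3 g by rewrite /g; lip3_tac lf.
have := contract_solid lg.
have n1 e : contract [sq fun x => g x e] \in null.
  by apply: contract_folded; [case: e; rewrite /g; lip2_tac lf | case: e; [left|right]].
have n2 e : contract [sq fun x y => g x y e] \in null.
  by apply: contract_folded; [case: e; rewrite /g; lip2_tac lf | case: e; [right|left]].
rewrite (rpredBr _ (rpredB (n2 false) (n2 true))).
by rewrite (rpredDr _ (rpredB (n1 false) (n1 true))) rpredN.
Qed.

Lemma contract_swap f : lip2 f ->
  contract [sq f] + contract [sq fun x y => f y x] \in null.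
Proof.
move=> lf; have lf' : lip2 (fun x y => f y (~~ x)) by lip2_tac lf.
have := rpredD (contract_rotate lf) (contract_reflect lf').
rewrite addrA subrK.
by rewrite [square (fun _ _ => f _ (~~ _))](square_ext (f' := fun x y => f y x)) // => x y; rewrite negbK.
Qed.

Definition null_eq (e : bool) (x y : Qchain G 2) := x - (if e then - y else y) \in null.

Lemma null_eq_trans e e' x y z :
  null_eq e x y -> null_eq e' y z -> null_eq (e (+) e') x z.
Proof.
rewrite /null_eq; case: e; last by move=> xy /(rpredD xy); rewrite subrKA; case: e'.
move=> xy; rewrite -rpredN opprB => /(rpredD xy).
by rewrite opprK addrA addrAC addrK; case: e'; rewrite /= ?opprK.
Qed.

Lemma contract_xor1 f a : lip2 f ->
  null_eq a (contract [sq fun x => f (x (+) a)]) (contract [sq f]).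
Proof.
move=> lf; rewrite /null_eq; case: a.
  have := contract_reflect lf; rewrite addrC opprK.
  by rewrite (square_ext (f' := fun x => f (x (+) true))) // => x y; rewrite addbT.
rewrite (square_ext (f' := f)) ?subrr ?rpred0 // => x y; by rewrite addbF.
Qed.

Lemma contract_swap_eq f : lip2 f ->
  null_eq true (contract [sq f]) (contract [sq fun x y => f y x]).
Proof. by move=> lf; rewrite /null_eq opprK contract_swap. Qed.

Lemma contract_xor f a b : lip2 f ->
  null_eq (a (+) b) (contract [sq fun x y => f (x (+) a) (y (+) b)]) (contract [sq f]).
Proof.
move=> lf; have lf1 : lip2 (fun x y => f y x) by lip2_tac lf.
have lf2 : lip2 (fun x y => f x (y (+) b)) by case: b; lip2_tac lf.
(* Reflection in the second coordinate is the reflection in the first conjugated by the swap, whose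
   two signs cancel. *)
have := null_eq_trans (contract_xor1 a lf2) (null_eq_trans (contract_swap_eq lf2)
  (null_eq_trans (contract_xor1 b lf1) (contract_swap_eq lf1))).
by rewrite addbT addTb negbK.
Qed.

Lemma perm2P (p : 'S_2) :
  (p o20 = o20 /\ p o21 = o21) \/ (p o20 = o21 /\ p o21 = o20).
Proof.
have : p o20 != p o21 by rewrite (inj_eq perm_inj).
by move: (p o20) (p o21); apply: ord2P; apply: ord2P => //; [left|right].
Qed.

Lemma det_mx22 (R : comPzRingType) (M : 'M[R]_2) :
  \det M = M o20 o20 * M o21 o21 - M o20 o21 * M o21 o20.
Proof.
rewrite (expand_det_row _ o20) !big_ord_recl big_ord0 addr0 /cofactor !det_mx11 !mxE /=.
rewrite expr0 mul1r expr1 mulN1r mulrN.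
by congr (_ * M _ _ - M _ _ * M _ _); apply/val_inj.
Qed.

Lemma det_signed2 p c (g : cube 2 -> cube 2) : signed_perm p c g ->
  \det (linear_part g) = (-1) ^+ ((p o20 == o21) (+) (c o20 (+) c o21)).
Proof.
move=> gE; rewrite det_mx22 !(linear_part_signed gE).
have [[-> ->]|[-> ->]] := perm2P p; rewrite /= !(mul1r, mul0r, subr0, sub0r).
  by rewrite signr_addb.
by rewrite signrN signr_addb.
Qed.

(** Reflections and the swap generate the symmetries of the square, and each changes [contract] by
    its determinant. This is the rule by which [cell_class] changes. *)
Lemma contract_signed (s t : scube G 2) p c g : signed_perm p c g ->
  (forall x, s x = t (g x)) ->
  contract (gen s) - \det (linear_part g) *: contract (gen t) \in null.
Proof.
move=> gE st; rewrite (det_signed2 gE).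
set e := _ (+) _; have -> : (-1) ^+ e *: contract (gen t) = if e then - contract (gen t) else contract (gen t).
  by case: (e); rewrite ?expr0 ?expr1 ?scaleN1r ?scale1r.
rewrite -/(null_eq e _ _) {}/e.
have lt := scube_lip2 t; have lt' : lip2 (fun x y => t (pt 2 [:: y; x])) by lip2_tac lt.
rewrite [t]square_eta [s]square_eta; set f := fun x y => t _.
have gpt x y : g (pt 2 [:: x; y]) = if p o20 == o20 then pt 2 [:: x (+) c o20; y (+) c o21]
    else pt 2 [:: y (+) c o21; x (+) c o20].
  have := gE (pt 2 [:: x; y]) o20; have := gE (pt 2 [:: x; y]) o21.
  by have [[-> ->]|[-> ->]] := perm2P p; rewrite !ffunE /= => e1 e0; rewrite [LHS]pt2_eta e0 e1.
have -> : square (fun x y => s (pt 2 [:: x; y])) = if p o20 == o20 then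
    square (fun x y => f (x (+) c o20) (y (+) c o21)) else
    square (fun x y => f (y (+) c o21) (x (+) c o20)).
  by rewrite /f; case: ifP => p0; apply: square_ext => x y; rewrite st gpt p0.
have [[-> _]|[-> _]] := perm2P p => /=; first exact: contract_xor.
rewrite -addbT; apply: (null_eq_trans (contract_xor (c o20) (c o21) lt')).
exact: contract_swap_eq.
Qed.
End Squares.

(** * Noninjective squares in a triangle-free graph *)

Section Folded.
Variable G : sgraph.
Hypothesis hG1 : quasimonophobic_graph G 1.
Implicit Types (f : bool -> bool -> G).

(** A triangle gives the noninjective square with corners [a], [a], [b], [c]. Exactly one of its
    sides is supported by the edge [ab]: the others are constant or contain [c]. *)
Lemma triangle_free (a b c : G) : adj a b -> adj b c -> ~ adj a c.
Proof.
move=> ab bc ac; have nab : near a b by left.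
pose f x y := if x then (if y then c else b) else a.
have lf : lip2 f by split=> -[]; [left|left|left|right].
pose Q := @graph_image (cube_graph 1) G (edge a b).
have cQ : is_cube 1 Q by exists (edge a b); apply/inj_iso/edge_inj.
have QV v : sverts Q v <-> v = a \/ v = b.
  split=> [[x <-]|[->|->]].
  - by rewrite [x]pt1_eta edgeE //; case: (x _); [right|left].
  - by exists (pt 1 [:: false]); rewrite edgeE.
  - by exists (pt 1 [:: true]); rewrite edgeE.
have ncQ : ~ sverts Q c.
  by move=> /QV[] e; [rewrite e adj_irr in ac | rewrite e adj_irr in bc].
have [_ qQ] := hG1 cQ.
have [||i [e [ie sQ]]] := qQ (square f) _ o21 false.
- move=> f_inj; have : pt 2 [:: false; false] = pt 2 [:: false; true].
    by apply: f_inj; rewrite !squareE.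
  by move=> /ffunP /(_ o21); rewrite !ffunE.
- by rewrite (proj2 (face_square lf _)).
have img x : sverts Q (face i e (square f) (pt 1 [:: x])).
  by rewrite -sQ; exists (pt 1 [:: x]).
case: (face_square lf e) img sQ ie; move: i; apply: ord2P.
  move=> e0 _ img sQ _; case: e e0 img sQ => e0.
    move=> img _; apply: ncQ.
    by have := img true; rewrite e0 edgeE //=; left.
  move=> _; rewrite e0 => sQ.
  have : sverts Q b by apply/QV; right.
  rewrite -sQ => -[x]; rewrite [x]pt1_eta edgeE; last by right.
  by rewrite /= if_same => ba; rewrite ba adj_irr in ab.
move=> _ e1 img _; case: e e1 img => e1 img ie; last by case: ie.
by apply: ncQ; have := img true; rewrite e1 edgeE //=; left.
Qed.

(** If opposite corners differ and one side is constant, the three remaining values are pairwise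
    near; absence of triangles then makes the parallel side constant. If no side is constant either,
    all four corners are distinct. *)
Lemma noninj_folded f : lip2 f -> ~ injective (square f) ->
  degenerate (square f) \/ folded f.
Proof.
move=> lf ninj; have [f1 f2] := lf.
have tri (x y z : G) : near x y -> near y z -> near x z -> [\/ x = y, y = z | x = z].
  move=> [xy|]; last by constructor 1.
  move=> [yz|]; last by constructor 2.
  by move=> [xz|]; [case: (triangle_free xy yz xz) | constructor 3].
have nfold : ~ folded f -> f false false <> f true true /\ f false true <> f true false.
  by move=> nf; split=> e; apply: nf; [left|right].
have [ff|nf] := pselect (folded f); [by right|left].
have [d1 d2] := nfold nf.
have [h1|h1] := pselect (f false false = f false true).
  have := f2 true; have := f1 true; have := f1 false; rewrite h1 in d1 * => n1 n2 n3.
  case: (tri _ _ _ (near_sym n1) n2 n3) => e; [congruence|congruence|].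
  by apply: square_degenerate2 => // -[].
have [h2|h2] := pselect (f false false = f true false).
  have := f2 true; have := f1 true; have := f2 false; rewrite h2 in d1 * => n1 n2 n3.
  case: (tri _ _ _ (near_sym n1) n3 n2) => e; [congruence|congruence|].
  by apply: square_degenerate1 => // -[].
have [h3|h3] := pselect (f true false = f true true).
  have := f2 false; have := f1 true; have := f1 false; rewrite h3 in d2 * => n1 n2 n3.
  by case: (tri _ _ _ n3 n2 n1) => e; congruence.
have [h4|h4] := pselect (f false true = f true true).
  have := f2 false; have := f2 true; have := f1 false; rewrite h4 in d2 * => n1 n2 n3.
  by case: (tri _ _ _ n1 n2 n3) => e; congruence.
case: ninj => x y; rewrite [x]pt2_eta [y]pt2_eta !squareE //.
by case: (x _) (x _) (y _) (y _) => [] [] [] [] // e; exfalso; congruence.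
Qed.
End Folded.

(** * A finite check on 3-cubes relative to a 4-cycle *)

Section Patterns.
Local Open Scope nat_scope.

(* The position of a vertex of [G] in a fixed 4-cycle, [None] if it is outside. *)
Definition position := option (bool * bool).

Definition positions : seq position :=
  [:: None; Some (false, false); Some (false, true);
      Some (true, false); Some (true, true)].

(** What nearness implies for positions in a rigid 4-cycle: two of its vertices that are near are
    not opposite. A vertex outside the cycle imposes no condition. *)
Definition close (p q : position) : bool :=
  match p, q with
  | Some (a, b), Some (c, d) => ~~ (a (+) c) || ~~ (b (+) d)
  | _, _ => true
  end.

Definition apart (p q : bool * bool) : bool :=
  let: (a, b) := p in let: (c, d) := q in (a (+) c) || (b (+) d).

(* [Some b] if the four positions parametrise the 4-cycle with degree [(-1)^b]. *)
Definition orientation (p00 p01 p10 p11 : position) : option bool :=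
  match p00, p01, p10, p11 with
  | Some a, Some b, Some c, Some d =>
    if [&& apart a d, apart b c, apart a b, apart a c, apart b d & apart c d]
    then Some (~~ (c.1 (+) a.1) (+) (a.1 (+) a.2)) else None
  | _, _, _, _ => None
  end.

Definition slice_orientation (p : bool -> bool -> position) :=
  orientation (p false false) (p false true) (p true false) (p true true).

(** The negations reproduce the signs of the six faces in the cubical boundary, up to one global
    sign. *)
Definition face_orientations (p : bool -> bool -> bool -> position) : seq (option bool) :=
  [:: slice_orientation (p false); omap negb (slice_orientation (p true));
      omap negb (slice_orientation (fun x => p x false)); slice_orientation (fun x => p x true);
      slice_orientation (fun x y => p x y false);
      omap negb (slice_orientation (fun x y => p x y true))].

Definition count_sign (b : bool) : seq (option bool) -> nat :=
  count (fun o => if o is Some c then b == c else false).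

(* The second alternative is the one that quasimonophobicity excludes. *)
Definition balanced l :=
  (count_sign true l == count_sign false l) || (count_sign true l + count_sign false l == 1).

(** Exhaustive verification over the five possible positions of each of the eight vertices. The
    closeness conditions are interleaved with the quantifiers to prune the search early. *)
Lemma face_orientations_balanced (p : bool -> bool -> bool -> position) :
  (forall y z, close (p false y z) (p true y z)) ->
  (forall x z, close (p x false z) (p x true z)) ->
  (forall x y, close (p x y false) (p x y true)) ->
  balanced (face_orientations p).
Proof.
pose cube_of (a b c d e f g h : position) (x y z : bool) :=
  if x then if y then if z then h else g else if z then f else e
  else if y then if z then d else c else if z then b else a.
have : all (fun a => all (fun b => close a b ==>
  all (fun c => close a c ==> all (fun d => close b d && close c d ==>
  all (fun e => close a e ==> all (fun f => close b f && close e f ==>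
  all (fun g => close c g && close e g ==>
  all (fun h => [&& close d h, close f h & close g h] ==>
    balanced (face_orientations (cube_of a b c d e f g h)))
  positions) positions) positions) positions) positions) positions) positions) positions.
  by vm_compute.
have mem q : q \in positions by case: q => [[[] []]|].
move=> E h1 h2 h3.
move/allP: E => /(_ (p false false false) (mem _)).
move/allP => /(_ (p false false true) (mem _)); rewrite h3 implyTb.
move/allP => /(_ (p false true false) (mem _)); rewrite h2 implyTb.
move/allP => /(_ (p false true true) (mem _)); rewrite h2 h3 implyTb.
move/allP => /(_ (p true false false) (mem _)); rewrite h1 implyTb.
move/allP => /(_ (p true false true) (mem _)); rewrite h1 h3 implyTb.
move/allP => /(_ (p true true false) (mem _)); rewrite h1 h2 implyTb.
by move/allP => /(_ (p true true true) (mem _)); rewrite h1 h2 h3 implyTb.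
Qed.
End Patterns.

(** * Coefficients of a 2-cell read off from positions *)

Section CellPattern.
Variable G : sgraph.
Variable D : cw_cell G 2.
Hypothesis rigD : rigid (cell_subgraph D).

Definition locate (v : G) : position :=
  [pick q : bool * bool | char_map D (pt 2 [:: q.1; q.2]) == v].

Lemma locateP v a b : locate v = Some (a, b) <-> char_map D (pt 2 [:: a; b]) = v.
Proof.
have [D_inj _ _] := char_mapP D.
rewrite /locate; case: pickP => [[c d] /= /eqP cd|no]; split=> //.
- by case=> <- <-.
- rewrite -cd => /D_inj/ffunP e; have := e o20; have := e o21.
  by rewrite !ffunE /= => -> ->.
by move=> e; have := no (a, b); rewrite /= e eqxx.
Qed.

Lemma locate_char x : locate (char_map D x) = Some (x o20, x o21).
Proof. by apply/locateP; rewrite -pt2_eta. Qed.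

Lemma apartP p q : apart p q = (p != q).
Proof. by case: p q => [[] []] [[] []]. Qed.

Lemma near_close u v : near u v -> close (locate u) (locate v).
Proof.
have [D_inj DV DA] := char_mapP D.
move=> nuv; case eu: (locate u) => [[a b]|//]; case ev: (locate v) => [[c d]|//].
move/locateP: eu => eu; move/locateP: ev => ev.
case: nuv => [uv|]; last first.
  rewrite -eu -ev => /D_inj /ffunP e; have := e o20; rewrite !ffunE /= => ->.
  by rewrite addbb.
have : sadj (cell_subgraph D) u v.
  by apply: rigD => //; apply/DV; [exists (pt 2 [:: a; b]) | exists (pt 2 [:: c; d])].
rewrite -eu -ev => /DA /cube_adjP[j]; move: j; apply: ord2P => /ffunP e.
  by have := e o21; rewrite !ffunE /= addbF => ->; rewrite addbb orbT.
by have := e o20; rewrite !ffunE /= addbF => ->; rewrite addbb.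
Qed.

Definition cube_orientation (s : scube G 2) :=
  slice_orientation (fun x y => locate (s (pt 2 [:: x; y]))).

(** Four distinct positions define an injective [g], which preserves adjacency by rigidity and hence
    is a signed permutation. The image of (0,0) gives its two signs, and whether the first
    coordinate changes between the images of (0,0) and (1,0) tells if it swaps the coordinates. *)
Lemma cube_orientation_param (s : scube G 2) e : cube_orientation s = Some e ->
  exists p c g, [/\ signed_perm p c g, forall x, s x = char_map D (g x)
    & \det (linear_part g) = (-1) ^+ e].
Proof.
have [D_inj DV DA] := char_mapP D.
rewrite /cube_orientation /slice_orientation /orientation.
case e00: (locate _) => [a|//]; case e01: (locate _) => [b|//].
case e10: (locate _) => [c|//]; case e11: (locate _) => [d|//].
rewrite !apartP; case: ifP => // /and5P[ad bc ab ac /andP[bd cd]] [eE].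
pose g (x : cube 2) : cube 2 :=
  let q := if x o20 then (if x o21 then d else c) else (if x o21 then b else a) in
  pt 2 [:: q.1; q.2].
have sg x : s x = char_map D (g x).
  rewrite [x]pt2_eta /g !ffunE /=; symmetry; apply/locateP; rewrite -surjective_pairing.
  by case: (x o20) (x o21) => [] [].
have g_inj : injective g.
  move=> x y /ffunP gxy; have := gxy o20; have := gxy o21.
  rewrite !ffunE /= => e1 e0; rewrite [x]pt2_eta [y]pt2_eta.
  have : (if x o20 then (if x o21 then d else c) else (if x o21 then b else a)) =
         (if y o20 then (if y o21 then d else c) else (if y o21 then b else a)).
    by rewrite [LHS]surjective_pairing e0 e1 -surjective_pairing.
  by case: (x o20) (x o21) (y o20) (y o21) => [] [] [] [] // e';
    move: ad bc ab ac bd cd; rewrite e' ?eqxx.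
have g_aut : cube_aut g.
  split=> // x y xy; apply/DA; rewrite -!sg; apply: rigD.
  - by apply/DV; exists (g x).
  - by apply/DV; exists (g y).
  have := scubeP s xy; case=> // sxy; move: xy; rewrite !sg in sxy.
  by rewrite (g_inj _ _ (D_inj _ _ sxy)) /= cube_adj_irr.
have [p [h gE]] := cube_aut_signed_perm g_aut.
exists p, h, g; split=> //; rewrite (det_signed2 gE) -eE.
have := gE (pt 2 [:: false; false]) o20; have := gE (pt 2 [:: false; false]) o21.
have := gE (pt 2 [:: true; false]) o20; have := gE (pt 2 [:: true; false]) o21.
have [[-> ->]|[-> ->]] := perm2P p; rewrite !ffunE /= => e1 e2 e3 e4; rewrite ?e1 ?e2 ?e3 ?e4.
  by case: (h o20) (h o21) => [] [].
by case: (h o20) (h o21) => [] [].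
Qed.

Lemma param_cube_orientation (s : scube G 2) (g : cube 2 -> cube 2) :
  injective g -> (forall x, s x = char_map D (g x)) -> cube_orientation s.
Proof.
move=> g_inj sg; rewrite /cube_orientation /slice_orientation !sg !locate_char /orientation.
have ap x y x' y' : (x, y) != (x', y') ->
    apart (g (pt 2 [:: x; y]) o20, g (pt 2 [:: x; y]) o21)
          (g (pt 2 [:: x'; y']) o20, g (pt 2 [:: x'; y']) o21).
  move=> ne; rewrite apartP; apply: contra_neq ne => -[e0 e1].
  have /g_inj/ffunP e : g (pt 2 [:: x; y]) = g (pt 2 [:: x'; y']).
    by rewrite [LHS]pt2_eta [RHS]pt2_eta e0 e1.
  by have := e o20; have := e o21; rewrite !ffunE /= => -> ->.
by rewrite !ap.
Qed.

Definition sign_value (o : option bool) : int := if o is Some b then (-1) ^+ b else 0.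

Lemma coeff_collapse (s : scube G 2) :
  coeff D (collapse G 2 (gen s)) = sign_value (cube_orientation s).
Proof.
case eo: (cube_orientation s) => [e|] /=.
  have [p [c [g [gE sg de]]]] := cube_orientation_param eo.
  have [D_inj _ _] := char_mapP D; have [g_inj _] := signed_perm_aut gE.
  rewrite collapse_inj; last by move=> x y; rewrite !sg => /D_inj/g_inj.
  by rewrite (cell_class_char gE sg) coeffZ coeffU eqxx de !mulr1.
have [s_inj|s_ninj] := pselect (injective s); last by rewrite collapse_noninj ?coeff0.
have [D' [p [c [g [gE sg]]]]] := inj_char s_inj.
rewrite (collapse_inj s_inj) (cell_class_char gE sg) coeffZ coeffU.
have [DD'|_] := eqVneq D' D; last by rewrite !mulr0.
rewrite DD' in sg; have [g_inj _] := signed_perm_aut gE.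
by have := param_cube_orientation g_inj sg; rewrite eo.
Qed.

Lemma supportedP (s : scube G 2) :
  supported s (cell_subgraph D) <-> cube_orientation s.
Proof.
have [D_inj DV DA] := char_mapP D; split=> [sD|].
  have /choice[g sg] x : exists y, s x = char_map D y.
    have /DV[y <-] : sverts (cell_subgraph D) (s x) by rewrite -sD; exists x.
    by exists y.
  apply: (param_cube_orientation _ sg).
  (* Surjectivity of [g] provides a right inverse [h]; it is injective, hence bijective on the
     finite cube, so [g] is injective. *)
  have /choice[h hE] y : exists x, g x = y.
    have : sverts (cell_subgraph D) (char_map D y) by apply/DV; exists y.
    by rewrite -sD => -[x]; rewrite sg => /D_inj; exists x.
  have h_inj : injective h by apply: can_inj hE.
  have [k hk kh] := injF_bij h_inj.
  by move=> x y gxy; rewrite -[x]kh -[y]kh -[k x]hE -[k y]hE !kh gxy.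
case eo: (cube_orientation s) => [e|//] _.
have [p [c [g [gE sg _]]]] := cube_orientation_param eo.
by rewrite /supported (image_comp gE sg) (iso_image (char_mapP D)).
Qed.
End CellPattern.

(** * Collapsing the boundary of a noninjective 3-cube *)

Lemma count_sign_isSome l :
  (count_sign true l + count_sign false l = count isSome l)%N.
Proof. by elim: l => //= -[[]|] l; rewrite /count_sign /=; lia. Qed.

Lemma sum_sign_value (l : seq (option bool)) :
  \sum_(o <- l) sign_value o = (count_sign false l)%:Z - (count_sign true l)%:Z.
Proof.
elim: l => [|o l IHl]; first by rewrite big_nil.
by rewrite big_cons IHl /count_sign; case: o => [[]|] /=; rewrite ?expr0 ?expr1; lia.
Qed.

Lemma sign_value_negb o : sign_value (omap negb o) = - sign_value o.
Proof. by case: o => [[]|] //=; rewrite oppr0. Qed.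

Section Collapse.
Variable G : sgraph.

Lemma solid_eta (s : scube G 3) : s = solid (fun x y z => s (pt 3 [:: x; y; z])).
Proof.
by rewrite -[LHS]mkcube_eta; congr mkcube; apply/funext => x; rewrite {1}[x]pt3_eta.
Qed.

Lemma scube_lip3 (s : scube G 3) : lip3 (fun x y z => s (pt 3 [:: x; y; z])).
Proof.
split=> a b.
- have -> : pt 3 [:: true; a; b] = flip o30 (pt 3 [:: false; a; b]).
    by apply/ffunP; apply: ord3P; rewrite !ffunE /= ?addbF.
  exact: near_flip.
- have -> : pt 3 [:: a; true; b] = flip o31 (pt 3 [:: a; false; b]).
    by apply/ffunP; apply: ord3P; rewrite !ffunE /= ?addbF.
  exact: near_flip.
have -> : pt 3 [:: a; b; true] = flip o32 (pt 3 [:: a; b; false]).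
  by apply/ffunP; apply: ord3P; rewrite !ffunE /= ?addbF.
exact: near_flip.
Qed.

Lemma collapse_bd_inj n (s : scube G n.+1) : injective s ->
  collapse G n (bdQ G n (gen s)) = bdCW G n (cell_class s).
Proof.
move=> s_inj; rewrite bdCW_class // bdQ_genE raddfN raddf_sum /=; congr (- _).
apply: eq_bigr => i _; rewrite raddf_sum /=; apply: eq_bigr => e _.
rewrite raddfMz /= collapse_inj; last exact: face_inj.
by rewrite -[X in X *: _]intz scaler_int.
Qed.

Lemma collapse_bd_char n (D : cw_cell G n.+1) :
  collapse G n (bdQ G n (gen (char_map D))) = bdCW G n (gen D).
Proof.
have [D_inj _ _] := char_mapP D.
by rewrite collapse_bd_inj // cell_class_char_map.
Qed.

(** The coefficient of each 2-cell [D] is a signed count of the faces supported by [D]. The finite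
    check makes it vanish unless there is exactly one such face, and quasimonophobicity then
    supplies a second. *)
Lemma collapse_bd3_noninj (s : scube G 3) : quasimonophobic_graph G 2 ->
  ~ injective s -> collapse G 2 (bdQ G 2 (gen s)) = 0.
Proof.
move=> hG2 s_ninj; apply/eqP/freeg_eqP => D; rewrite coeff0.
have cD : is_cube 2 (cell_subgraph D) by have /asboolP := valP D.
have [rigD qmD] := hG2 _ cD.
pose B (q : 'I_3 * bool) := isSome (cube_orientation D (face q.1 q.2 s)).
have qmB q : B q -> exists2 q', q' != q & B q'.
  case: q => i e /(supportedP rigD) sup; have [i' [e' [ne sup']]] := qmD s s_ninj i e sup.
  by exists (i', e'); [apply/eqP | apply/(supportedP rigD)].
have lg := scube_lip3 s; rewrite [s]solid_eta in B qmB *.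
set g := fun x y z => s _ in B qmB lg *.
have [g1 g2 g3] := lg.
have l1 e : lip2 (g e) by split=> y; [apply: g2 | apply: g3].
have l2 e : lip2 (fun x => g x e) by split=> y; [apply: g1 | apply: g3].
have l3 e : lip2 (fun x y => g x y e) by split=> y; [apply: g1 | apply: g2].
have oE f : lip2 f -> cube_orientation D (square f) = slice_orientation (fun x y => locate D (f x y)).
  by move=> lf; rewrite /cube_orientation /slice_orientation !squareE.
pose p x y z := locate D (g x y z).
have oE1 e : cube_orientation D (square (g e)) = slice_orientation (p e) by rewrite oE.
have oE2 e : cube_orientation D (square (fun x => g x e)) = slice_orientation (fun x => p x e).
  by rewrite oE.
have oE3 e : cube_orientation D (square (fun x y => g x y e)) = slice_orientation (fun x y => p x y e).
  by rewrite oE.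
have := face_orientations_balanced (p := p)
  (fun y z => near_close rigD (g1 y z)) (fun y z => near_close rigD (g2 y z))
  (fun y z => near_close rigD (g3 y z)).
rewrite /balanced count_sign_isSome => bal.
have {}bal : count_sign true (face_orientations p) = count_sign false (face_orientations p).
  case/orP: bal => /eqP // c1.
  have cardB : #|[pred q | B q]| = count isSome (face_orientations p).
    rewrite -sum1_card big_mkcond -(pair_bigA _ (fun i e => if B (i, e) then 1%N else 0%N)) /=.
    rewrite !big_ord_recl big_ord0 /B /= !big_bool.
    rewrite (_ : lift ord0 ord0 = o31); last exact/val_inj.
    rewrite (_ : lift ord0 _ = o32); last exact/val_inj.
    have [-> -> ->] := face_solid lg false; have [-> -> ->] := face_solid lg true.
    rewrite !oE1 !oE2 !oE3.
    have on o : isSome (omap negb o) = isSome o by case: o.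
    have ifE (b : bool) : (if b then 1 else 0)%N = b :> nat by case: b.
    by rewrite /face_orientations /= !on !ifE; lia.
  have [q qE] := mem_card1 (etrans cardB c1).
  have Bq : B q by have := qE q; rewrite !inE eqxx.
  have [q' ne Bq'] := qmB q Bq.
  by have := qE q'; rewrite !inE Bq' (negPf ne).
have := sum_sign_value (face_orientations p); rewrite bal subrr.
rewrite /face_orientations !big_cons big_nil !sign_value_negb.
rewrite bdQ_solid // !(raddfB, raddfD, raddfN) /= !coeff_collapse //.
(* The list of orientations carries the signs opposite to those of [bdQ_solid], whence the
   negation. *)
rewrite !oE1 !oE2 !oE3 => /(congr1 -%R); rewrite oppr0 => <-; ring.
Qed.
End Collapse.

(** * The isomorphism in degree 2 *)

Section Main.
Variable G : sgraph.
Notation null := (@null_homologous G 2).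

Lemma collapse_htpy c : collapse G 2 (htpy G c) = 0.
Proof.
move: c; apply: (freeg_additive0 (h := collapse G 2 \o htpy G)) => s /=.
rewrite htpy_gen; case: ifP => _; first by rewrite raddf0.
have ls := lip2_backtrack (near_sym (scube_near_edge s)).
rewrite collapse_noninj // => s_inj.
have : pt 2 [:: false; false] = pt 2 [:: false; true].
  by apply: s_inj; rewrite !squareE.
by move=> /ffunP /(_ o21); rewrite !ffunE.
Qed.

(** A right inverse of [collapse]. The correction by [contract] makes it commute with boundaries,
    relative to [cell_lift1] and modulo degenerate edges, so that cellular cycles lift to cycles. *)
Definition cell_lift2 : {additive CWchain G 2 -> Qchain G 2} :=
  fglift (fun D : cw_cell G 2 => contract G (gen (char_map D)) : Qchain G 2).

Lemma cell_lift2_gen D : cell_lift2 (gen D) = contract G (gen (char_map D)).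
Proof. exact: fglift_gen. Qed.

Lemma collapse_cell_lift2 z : collapse G 2 (cell_lift2 z) = z.
Proof.
apply/eqP; rewrite -subr_eq0; apply/eqP; move: z.
apply: (freeg_additive0 (h := (collapse G 2 \o cell_lift2) \- idfun)) => D /=.
have [D_inj _ _] := char_mapP D.
rewrite cell_lift2_gen raddfB /= collapse_htpy subr0.
by rewrite collapse_inj // cell_class_char_map subrr.
Qed.

Lemma bdQ_cell_lift2 z :
  bdQ G 1 (cell_lift2 z) - cell_lift1 G (bdCW G 1 z) \in @Dchain G 1.
Proof.
pose r := (bdQ G 1 \o cell_lift2) \- (cell_lift1 G \o bdCW G 1).
apply: (freeg_additive_closed (S := @Dchain G 1) (h := r)) z => D /=.
by rewrite cell_lift2_gen raddfB /= -collapse_bd_char htpy1.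
Qed.

Lemma homology_class_lift z : bdCW G 1 z = 0 -> bdQ G 1 (cell_lift2 z) \in @Dchain G 1.
Proof. by move=> z0; have := bdQ_cell_lift2 z; rewrite z0 raddf0 subr0. Qed.

Hypothesis hG1 : quasimonophobic_graph G 1.
Hypothesis hG2 : quasimonophobic_graph G 2.

(** The boundary of a folded square is zero or a difference of two sums of an edge and its reverse,
    which collapse to 0. *)
Lemma collapse_bd2 c : collapse G 1 (bdQ G 1 c) = bdCW G 1 (collapse G 2 c).
Proof.
apply/eqP; rewrite -subr_eq0; apply/eqP; move: c.
apply: (freeg_additive0 (h := (collapse G 1 \o bdQ G 1) \- (bdCW G 1 \o collapse G 2))) => s /=.
have [s_inj|s_ninj] := pselect (injective s).
  by rewrite collapse_bd_inj // collapse_inj // subrr.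
rewrite [collapse G 2 _]collapse_noninj // raddf0 subr0.
have ls := scube_lip2 s; rewrite [s]square_eta in s_ninj *.
set f := fun x y => s _ in ls s_ninj *; have [f1 f2] := ls.
case: (noninj_folded hG1 ls s_ninj) => [ds|[e|e]].
- by apply/collapse_degenerate/bdQ_Dchain/Dchain_gen.
- rewrite bdQ_diagonal // raddfB /= !collapse_edge_sym ?subrr //; exact: near_sym.
by rewrite bdQ_antidiagonal // raddf0.
Qed.

Lemma collapse_bd3 c : exists d, collapse G 2 (bdQ G 2 c) = bdCW G 2 d.
Proof.
exists (collapse G 3 c); apply/eqP; rewrite -subr_eq0; apply/eqP; move: c.
apply: (freeg_additive0 (h := (collapse G 2 \o bdQ G 2) \- (bdCW G 2 \o collapse G 3))) => s /=.
have [s_inj|s_ninj] := pselect (injective s).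
  by rewrite collapse_bd_inj // collapse_inj // subrr.
by rewrite [collapse G 3 _]collapse_noninj // raddf0 subr0 collapse_bd3_noninj.
Qed.

(** Injective squares reduce to characteristic maps by the determinant rule; noninjective ones are
    degenerate or folded, so that both terms vanish up to homology. *)
Lemma contract_collapse c : contract G c - cell_lift2 (collapse G 2 c) \in null.
Proof.
pose r := contract G \- (cell_lift2 \o collapse G 2).
apply: (freeg_additive_closed (S := null) (h := r)) c => s /=.
have [s_inj|s_ninj] := pselect (injective s).
  have [D [p [c [g [gE sD]]]]] := inj_char s_inj.
  rewrite collapse_inj // (cell_class_char gE sD) -[X in X *: _]intz scaler_int.
  by rewrite raddfMz /= cell_lift2_gen -scaler_int intz (contract_signed gE sD).
rewrite collapse_noninj // raddf0 subr0.
have ls := scube_lip2 s; rewrite [s]square_eta in s_ninj *.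
case: (noninj_folded hG1 ls s_ninj) => [ds|fs].
  exact: contract_degenerate.
exact: contract_folded.
Qed.

(** The cellular boundary of [D] is the collapse of the singular boundary of [char_map D], and
    [contract] preserves null-homologous chains. *)
Lemma cell_lift2_bd w : cell_lift2 (bdCW G 2 w) \in null.
Proof.
apply: (freeg_additive_closed (S := null) (h := cell_lift2 \o bdCW G 2)) w => D /=.
have := contract_collapse (bdQ G 2 (gen (char_map D))).
rewrite rpredBl; first by rewrite collapse_bd_char.
exact/contract_null/null_homologous_bd.
Qed.

Lemma null_of_collapse c w : bdQ G 1 c \in @Dchain G 1 ->
  collapse G 2 c = bdCW G 2 w -> c \in null.
Proof.
move=> c0 cw; have := contract_collapse c; rewrite cw (rpredBr _ (cell_lift2_bd w)).
by rewrite /contract /= rpredBr // htpy_degenerate.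
Qed.

Definition collapseC (c : Cchain G 2) : CWchain G 2 := collapse G 2 (repr c).

Lemma collapseC_pi c :
  collapseC (\pi_(Quotient.quot (@Dchain G 2)) c) = collapse G 2 c.
Proof.
apply/eqP; rewrite -subr_eq0 -raddfB /=; apply/eqP/collapse_degenerate.
by rewrite Quotient.idealrBE reprK.
Qed.

Fact collapseC_is_additive : zmod_morphism collapseC.
Proof.
by move=> x y; rewrite -[x]reprK -[y]reprK -raddfB /= !collapseC_pi raddfB.
Qed.
HB.instance Definition _ :=
  GRing.isZmodMorphism.Build _ _ collapseC collapseC_is_additive.

Lemma pi_eq0 n (c : Qchain G n) :
  (\pi_(Quotient.quot (@Dchain G n)) c == 0) = (c \in @Dchain G n).
Proof.
by rewrite -(raddf0 (\pi_(Quotient.quot (@Dchain G n)))) -Quotient.idealrBE subr0.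
Qed.

Lemma homology2_iso :
  isomorphic (homology (cubical_complex G) 2) (homology (cw_complex G) 2).
Proof.
have bdC0 c : bdC G 1 c = 0 -> bdQ G 1 (repr c) \in @Dchain G 1.
  by rewrite -{1}[c]reprK /bdC /= bdC_pi => /eqP; rewrite pi_eq0.
apply: (@homology_iso (cubical_complex G) (cw_complex G) 1 collapseC) => /=.
- move=> c /bdC0 c0; rewrite -[c]reprK collapseC_pi -collapse_bd2.
  exact: collapse_degenerate.
- move=> c; have [d dE] := collapse_bd3 (repr c).
  by exists d; rewrite -dE -[c in LHS]reprK /bdC /= bdC_pi collapseC_pi.
(* Surjectivity: the lift of a cellular cycle is a cycle modulo degenerate edges and collapses
   exactly to the given one. *)
- move=> z /homology_class_lift z0; exists (\pi_(Quotient.quot (@Dchain G 2)) (cell_lift2 z)).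
    by rewrite /bdC /= bdC_pi; apply/eqP; rewrite pi_eq0.
  by rewrite collapseC_pi collapse_cell_lift2.
move=> c /bdC0 c0 [w]; rewrite -[c]reprK collapseC_pi => /(null_of_collapse c0).
move=> /asboolP[d cd]; exists (\pi_(Quotient.quot (@Dchain G 3)) d).
rewrite /bdC /= bdC_pi; apply/eqP; rewrite -subr_eq0 -raddfB /=.
by rewrite pi_eq0.
Qed.
End Main.

Local Close Scope ring_scope.

Theorem theorem5p22 (G : sgraph)
  (hG : forall n : nat, n <= 2 -> quasimonophobic_graph G n) :
  isomorphic (homology (cubical_complex G) 2) (homology (cw_complex G) 2).
Proof. by apply: homology2_iso; apply: hG. Qed.
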